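(* Let $R$ be a commutative Noetherian ring with identity, $\mathfrak{a}$ an ideal of $R$ which is contained in the Jacobson radical of $R$, and $M$ a finitely generated $R$-module with $c:=\mathrm{cd}(\mathfrak{a},M)=\mathrm{ara}(\mathfrak{a},M)$. Then the following are equivalent: (i) For every $\mathfrak{a}$-s.o.p $x_1,\ldots,x_c$ of $M$, $\mathfrak{a}\,\Gamma_{\langle x_{k+1}\rangle}\left(M/\langle x_1,\ldots,x_k\rangle M\right)=0$ for all $0\le k\le c-1$. (ii) $M$ is $\mathfrak{a}$-relative Buchsbaum. (iii) For every $\mathfrak{a}$-s.o.p $x_1,\ldots,x_c\in\mathfrak{a}$ of $M$ and every $0\le k\le c-1$, the $R$-module $M/\langle x_1,\ldots,x_k\rangle M$ is $\mathfrak{a}$-relative quasi Buchsbaum.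
   Context: $H^i_{\mathfrak{a}}$ is local cohomology and, for an ideal $\mathfrak{b}$, $\Gamma_{\mathfrak{b}}(N)=\bigcup_{t\ge 1}(0:_N\mathfrak{b}^t)$. $\mathrm{cd}(\mathfrak{a},M)$ is the supremum of the integers $i\ge 0$ with $H^i_{\mathfrak{a}}(M)\ne 0$ (with $\sup\emptyset=-\infty$). $\mathrm{ara}(\mathfrak{a},M)$ is the infimum of the integers $n\ge 0$ for which there exist $x_1,\ldots,x_n\in R$ such that $\langle x_1,\ldots,x_n\rangle$ and $\mathfrak{a}$ have the same radical in $R/\mathrm{Ann}_R M$. With $c=\mathrm{cd}(\mathfrak{a},M)$, a sequence $x_1,\ldots,x_c$ of elements of $\mathfrak{a}$ is an $\mathfrak{a}$-relative system of parameters ($\mathfrak{a}$-s.o.p) of $M$ if $\langle x_1,\ldots,x_c\rangle$ and $\mathfrak{a}$ have the same radical in $R/\mathrm{Ann}_R M$. A sequence $x_1,\ldots,x_r$ in $R$ is an $\mathfrak{a}$-weak sequence on $M$ if $\langle x_1,\ldots,x_{i-1}\rangle M:_M x_i\subseteq\langle x_1,\ldots,x_{i-1}\rangle M:_M\mathfrak{a}$ for all $i=1,\ldots,r$. A finitely generated $R$-module $M$ is $\mathfrak{a}$-relative Buchsbaum (respectively $\mathfrak{a}$-relative quasi Buchsbaum) if $\mathrm{cd}(\mathfrak{a},M)=\mathrm{ara}(\mathfrak{a},M)$ and every $\mathfrak{a}$-s.o.p of $M$ (respectively every $\mathfrak{a}$-s.o.p of $M$ contained in $\mathfrak{a}^2$)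 is an $\mathfrak{a}$-weak sequence on $M$. *)

(* Defs.v *)
From HB Require Import structures.
From mathcomp Require Import all_boot all_order all_algebra.
From mathcomp Require Import generic_quotient.
From mathcomp Require Import boolp classical_sets constructive_ereal.
Set Implicit Arguments.
Unset Strict Implicit.
Unset Printing Implicit Defensive.
Import Order.TTheory GRing.Theory Num.Theory.
Local Open Scope classical_set_scope.
Local Open Scope ring_scope.
Local Open Scope quotient_scope.

Definition is_submodule (R : comPzRingType) (V : lmodType R) (N : set V) :
    Prop :=
  [/\ N 0,
      forall u v, N u -> N v -> N (u + v) &
      forall (r : R) v, N v -> N (r *: v)].

Definition is_ideal (R : comPzRingType) (I : set R) : Prop :=
  @is_submodule R R^o I.

Definition submodule_span (R : comPzRingType) (V : lmodType R) (S : set V) :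
    set V :=
  smallest (@is_submodule R V) S.

Definition gen_ideal (R : comPzRingType) (xs : seq R) : set R :=
  @submodule_span R R^o [set` xs].

(* I N *)
Definition smul (R : comPzRingType) (I : set R) (V : lmodType R) (N : set V) :
    set V :=
  submodule_span [set r *: v | r in I & v in N].

(* I ^ t, with I ^ 0 = R *)
Definition ideal_exp (R : comPzRingType) (I : set R) (t : nat) : set R :=
  iter t (@smul R I R^o) setT.

Definition maximal_ideal (R : comPzRingType) : set (set R) :=
  [set m | [/\ is_ideal m, m != setT &
      forall J : set R, is_ideal J -> m `<=` J -> J = m \/ J = setT]].

Definition jacobson_radical (R : comPzRingType) : set R :=
  \bigcap_(m in @maximal_ideal R) m.

Definition noetherian (R : comPzRingType) : Prop :=
  forall I : set R, is_ideal I -> exists xs : seq R, I = gen_ideal xs.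

Definition fin_gen (R : comPzRingType) (M : lmodType R) : Prop :=
  exists ms : seq M, submodule_span [set` ms] = setT.

(* The quotient of V by the submodule spanned by N, which is V / N when N is  *)
(* a submodule.                                                               *)
Section QuotientModule.
Variables (R : comPzRingType) (V : lmodType R) (N : set V).

Lemma is_submodule_span : is_submodule (submodule_span N).
Proof.
split=> [W [[]] //|u v Nu Nv W [Wsub NW]|r v Nv W [Wsub NW]].
- by have [_ + _] := Wsub; apply; [apply: Nu|apply: Nv].
- by have [_ _] := Wsub; apply; apply: Nv.
Qed.

Definition quot_rel (u v : V) : bool := `[< submodule_span N (u - v) >].

Lemma quot_rel_refl : reflexive quot_rel.
Proof. by move=> u; apply/asboolP; rewrite subrr; case: is_submodule_span. Qed.

Lemma quot_rel_opp u v : quot_rel u v -> quot_rel v u.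
Proof.
move=> /asboolP uv; apply/asboolP; rewrite -opprB -scaleN1r.
by have [_ _] := is_submodule_span; apply.
Qed.

Lemma quot_rel_sym : symmetric quot_rel.
Proof. by move=> u v; apply/idP/idP; apply: quot_rel_opp. Qed.

Lemma quot_rel_trans : transitive quot_rel.
Proof.
move=> v u w /asboolP uv /asboolP vw; apply/asboolP.
rewrite -(subrKA v u); have [_ + _] := is_submodule_span; exact.
Qed.

Canonical quot_equiv := EquivRel quot_rel quot_rel_refl quot_rel_sym
  quot_rel_trans.

Definition quot_mod := {eq_quot quot_equiv}.
HB.instance Definition _ : EqQuotient V quot_equiv quot_mod :=
  EqQuotient.on quot_mod.
HB.instance Definition _ := Choice.on quot_mod.

Lemma quot_modP u v :
  \pi_quot_mod u = \pi_quot_mod v <-> submodule_span N (u - v).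
Proof.
split=> [/eqP|uv]; first by rewrite piE => /asboolP.
by apply/eqP; rewrite piE; apply/asboolP.
Qed.

Definition quot_zero : quot_mod := \pi_quot_mod 0.
Definition quot_opp (x : quot_mod) : quot_mod := \pi_quot_mod (- repr x).
Definition quot_add (x y : quot_mod) : quot_mod := \pi_quot_mod (repr x + repr y).
Definition quot_scale (r : R) (x : quot_mod) : quot_mod := \pi_quot_mod (r *: repr x).

Lemma quot_repr u : submodule_span N (repr (\pi_quot_mod u) - u).
Proof. by apply/quot_modP; rewrite reprK. Qed.

Lemma pi_quot_add u v :
  quot_add (\pi_quot_mod u) (\pi_quot_mod v) = \pi_quot_mod (u + v).
Proof.
apply/quot_modP; rewrite opprD addrACA.
by have [_ + _] := is_submodule_span; apply; apply: quot_repr.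
Qed.

Lemma pi_quot_scale r u :
  quot_scale r (\pi_quot_mod u) = \pi_quot_mod (r *: u).
Proof.
apply/quot_modP; rewrite -scalerBr.
by have [_ _] := is_submodule_span; apply; apply: quot_repr.
Qed.

Lemma pi_quot_opp u : quot_opp (\pi_quot_mod u) = \pi_quot_mod (- u).
Proof. by rewrite -[- u]scaleN1r -pi_quot_scale /quot_scale scaleN1r. Qed.

Lemma quot_addA : associative quot_add.
Proof.
move=> x y z; rewrite -[x]reprK -[y]reprK -[z]reprK.
rewrite (pi_quot_add (repr y)) (pi_quot_add (repr x) (repr y)).
by rewrite !pi_quot_add addrA.
Qed.

Lemma quot_addC : commutative quot_add.
Proof. by move=> x y; rewrite -[x]reprK -[y]reprK !pi_quot_add addrC. Qed.

Lemma quot_add0 : left_id quot_zero quot_add.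
Proof. by move=> x; rewrite -[x]reprK pi_quot_add add0r. Qed.

Lemma quot_addN : left_inverse quot_zero quot_opp quot_add.
Proof. by move=> x; rewrite -[x]reprK pi_quot_opp pi_quot_add addNr. Qed.

HB.instance Definition _ :=
  GRing.isZmodule.Build quot_mod quot_addA quot_addC quot_add0 quot_addN.

Lemma quot_scaleA r s (x : quot_mod) :
  quot_scale r (quot_scale s x) = quot_scale (r * s) x.
Proof. by rewrite -[x]reprK (pi_quot_scale s) !pi_quot_scale scalerA. Qed.

Lemma quot_scale1 : left_id 1 quot_scale.
Proof. by move=> x; rewrite -[x]reprK pi_quot_scale scale1r. Qed.

Lemma quot_scaleDr : right_distributive quot_scale +%R.
Proof.
move=> r x y; rewrite -[x]reprK -[y]reprK.
rewrite [LHS](congr1 (quot_scale r) (pi_quot_add _ _)) !pi_quot_scale.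
by rewrite scalerDr [RHS]pi_quot_add.
Qed.

Lemma quot_scaleDl x : {morph quot_scale^~ x : r s / r + s}.
Proof.
by move=> r s; rewrite -[x]reprK !pi_quot_scale scalerDl [RHS]pi_quot_add.
Qed.

HB.instance Definition _ := GRing.Zmodule_isLmodule.Build R quot_mod
  quot_scaleA quot_scale1 quot_scaleDr quot_scaleDl.

End QuotientModule.

(* M / <xs> M *)
Definition quot_seq (R : comPzRingType) (M : lmodType R) (xs : seq R) :
    lmodType R :=
  quot_mod (smul (gen_ideal xs) [set: M]).

Definition Gamma (R : comPzRingType) (b : set R) (V : lmodType R) : set V :=
  \bigcup_(t in [set t | (1 <= t)%N])
    [set v | forall r, ideal_exp b t r -> r *: v = 0].
Arguments Gamma {R} b V.

Definition injective_module (R : comPzRingType) (E : lmodType R) : Prop :=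
  forall (U V : lmodType R) (f : {linear U -> V}) (g : {linear U -> E}),
    injective f -> exists h : {linear V -> E}, forall u, h (f u) = g u.

Record injective_resolution (R : comPzRingType) (M : lmodType R) := InjRes {
  res_obj :> nat -> lmodType R;
  res_aug : {linear M -> res_obj 0%N};
  res_diff : forall i, {linear res_obj i -> res_obj i.+1};
  res_inj : forall i, injective_module (res_obj i);
  res_aug_inj : injective res_aug;
  res_exact0 : [set x | res_diff 0%N x = 0] = range res_aug;
  res_exactS : forall i, [set x | res_diff i.+1 x = 0] = range (res_diff i) }.

(* H^i_a(M) is the i-th cohomology of the complex Gamma_a(I) for an injective *)
(* resolution I of M, i.e. cocycles modulo coboundaries below.                *)
Definition lc_cocycle (R : comPzRingType) (a : set R) (M : lmodType R)
    (I : injective_resolution M) (i : nat) : set (I i) :=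
  Gamma a (I i) `&` [set z | res_diff I i z = 0].
Arguments lc_cocycle {R} a {M} I i.

Definition lc_coboundary (R : comPzRingType) (a : set R) (M : lmodType R)
    (I : injective_resolution M) (i : nat) : set (I i) :=
  match i return set (I i) with
  | 0%N => [set 0]
  | j.+1 => res_diff I j @` Gamma a (I j)
  end.
Arguments lc_coboundary {R} a {M} I i.

(* H^i_a(M) <> 0.  Up to isomorphism the cohomology does not depend on the    *)
(* resolution, and every module has one.                                      *)
Definition lc_nonzero (R : comPzRingType) (a : set R) (M : lmodType R)
    (i : nat) : Prop :=
  exists I : injective_resolution M,
    ~ (lc_cocycle a I i `<=` lc_coboundary a I i).

Definition cd (R : comPzRingType) (a : set R) (M : lmodType R) : \bar int :=
  supremum -oo%E [set (i%:Z)%:E | i in [set i : nat | lc_nonzero a M i]].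

Definition ann (R : comPzRingType) (M : lmodType R) : set R :=
  [set r | forall m : M, r *: m = 0].

(* The preimage in R of the radical of the extension of I to R / Ann_R M. *)
Definition radical_mod_ann (R : comPzRingType) (M : lmodType R) (I : set R) :
    set R :=
  [set r | exists n : nat, [set x + y | x in I & y in ann M] (r ^+ n)].

Definition same_radical (R : comPzRingType) (M : lmodType R) (I J : set R) :
    Prop :=
  radical_mod_ann M I = radical_mod_ann M J.

Definition ara (R : comPzRingType) (a : set R) (M : lmodType R) : \bar int :=
  infimum +oo%E [set (n%:Z)%:E | n in [set n : nat |
    exists xs : seq R, size xs = n /\ same_radical M (gen_ideal xs) a]].

Definition is_sop (R : comPzRingType) (a : set R) (M : lmodType R)
    (xs : seq R) : Prop :=
  [/\ cd a M = ((size xs)%:Z)%:E,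
      [set` xs] `<=` a &
      same_radical M (gen_ideal xs) a].

Definition colon_elt (R : comPzRingType) (V : lmodType R) (N : set V) (x : R) :
    set V :=
  [set v | N (x *: v)].

Definition colon_ideal (R : comPzRingType) (V : lmodType R) (N : set V)
    (a : set R) : set V :=
  [set v | forall r, a r -> N (r *: v)].

Definition weak_sequence (R : comPzRingType) (a : set R) (M : lmodType R)
    (xs : seq R) : Prop :=
  forall i : nat, (i < size xs)%N ->
    let N := smul (gen_ideal (take i xs)) [set: M] in
    colon_elt N xs`_i `<=` colon_ideal N a.

Definition relative_Buchsbaum (R : comPzRingType) (a : set R)
    (M : lmodType R) : Prop :=
  [/\ fin_gen M,
      cd a M = ara a M &
      forall xs : seq R, is_sop a M xs -> weak_sequence a M xs].

Definition relative_quasi_Buchsbaum (R : comPzRingType) (a : set R)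
    (M : lmodType R) : Prop :=
  [/\ fin_gen M,
      cd a M = ara a M &
      forall xs : seq R, is_sop a M xs -> [set` xs] `<=` ideal_exp a 2 ->
        weak_sequence a M xs].

(* Main.v *)
Require Import Defs.
From HB Require Import structures.
From mathcomp Require Import all_boot all_order all_algebra.
From mathcomp Require Import generic_quotient perm ring.
From mathcomp Require Import boolp classical_sets constructive_ereal.
Set Implicit Arguments.
Unset Strict Implicit.
Unset Printing Implicit Defensive.
Import Order.TTheory GRing.Theory Num.Theory.
Local Open Scope classical_set_scope.
Local Open Scope ring_scope.

(* Let y_1, ..., y_c generate a up to radical modulo Ann M. On an injective   *)
(* resolution the sequences 0 -> Gamma_(y,ys) -> Gamma_ys -> (Gamma_ys)_y ->  *)
(* 0 give H^i_a(M) = 0 for i > c, and H^c_a(M) = 0 iff for all n and m there  *)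
(* is k with (y_1...y_c)^k m in (y_1^(n+k), ..., y_c^(n+k)) M. This criterion *)
(* passes from M / y_1 M and y_2, ..., y_c to M and y_1, ..., y_c, so that    *)
(* for an a-s.o.p x of M the module N = M / (x_1, ..., x_k) M has cd = ara =  *)
(* c - k. By the determinant trick every a-s.o.p of N prolongs x_1, ..., x_k  *)
(* to an a-s.o.p of M. The three conditions are then compared by replacing    *)
(* entries of an a-s.o.p by powers, in particular by squares, which lie in    *)
(* a^2.                                                                       *)

(** * Submodules and ideals *)

(** The three conditions are compared by exchanging entries of an a-s.o.p. Let N = M / (x_1, ...,
    x_k) M. If v in N is killed by a power of x_(k+1), replacing x_(k+1) by such a power gives
    another a-s.o.p of M, whose weak-sequence condition at this place says that a kills v; so (ii)
    gives (i), and (ii) is the case of exponent 1 of (i). For (iii) -> (ii), the squares of x_(k+1),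
    ..., x_c form an a-s.o.p of N inside a^2, and x_(k+1) v = 0 forces x_(k+1)^2 v = 0, so the first
    weak-sequence condition on the squares suffices. For (ii) -> (iii), an a-s.o.p of N prolongs
    x_1, ..., x_k to one of M ([sop_lift]), so its conditions are among those on M.

    The main content is that cd and ara of N are both c - k ([sop_quotient]). The remaining c - k
    entries generate a up to radical over N, so ara is at most c - k, and cd is at most ara by
    [lc_vanish_gt_size] and [same_radical_lc_vanish]. For H^(c-k)_a(N) <> 0, top cohomology is
    viewed as the direct limit of the modules M / (y_1^n, ..., y_c^n) M under multiplication by
    y_1...y_c. [lc_vanish_size] states its vanishing elementwise, and by [power_saturated_cat]
    vanishing for N would imply vanishing for M. Nonvanishing asks for an injective resolution,
    which [injective_resolution_exists] builds from Q/Z. *)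

Section Submodules.
Variables (R : comPzRingType) (V : lmodType R).
Implicit Types (N W : set V) (S : set V) (xs ys : seq R).

Lemma submod0 N : is_submodule N -> N 0.
Proof. by case. Qed.

Lemma submodD N u v : is_submodule N -> N u -> N v -> N (u + v).
Proof. by case=> _ + _; apply. Qed.

Lemma submodZ N r v : is_submodule N -> N v -> N (r *: v).
Proof. by case=> _ _; apply. Qed.

Lemma submodN N v : is_submodule N -> N v -> N (- v).
Proof. by move=> Ns Nv; rewrite -scaleN1r; apply: submodZ. Qed.

Lemma submodB N u v : is_submodule N -> N u -> N v -> N (u - v).
Proof. by move=> Ns Nu Nv; apply: submodD => //; apply: submodN. Qed.

Lemma submodBl N u v : is_submodule N -> N u -> N (v - u) -> N v.
Proof. by move=> Ns Nu; rewrite -{2}(subrK u v) => Nvu; apply: submodD. Qed.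

Lemma is_submodule0 : is_submodule [set 0 : V].
Proof.
split=> [//|u v /= -> ->|r v /= ->]; by rewrite ?addr0 ?scaler0.
Qed.

Lemma sub_span S : S `<=` submodule_span S.
Proof. exact: sub_gen_smallest. Qed.

Lemma span_min S N : is_submodule N -> S `<=` N -> submodule_span S `<=` N.
Proof. by move=> Ns SN; apply: smallest_sub. Qed.

Lemma span_id N : is_submodule N -> submodule_span N = N.
Proof.
by move=> Ns; apply/seteqP; split; [apply: span_min|apply: sub_span].
Qed.

Lemma is_submodule_preimage (U : lmodType R) (f : {linear U -> V}) N :
  is_submodule N -> is_submodule (f @^-1` N).
Proof.
move=> Ns; split=> [|u v|r v] /=; rewrite ?linear0 ?linearD ?linearZ.
- exact: submod0.
- exact: submodD.
- exact: submodZ.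
Qed.

Lemma is_submodule_range (U : lmodType R) (f : {linear U -> V}) :
  is_submodule (range f).
Proof.
split=> [|_ _ [u _ <-] [v _ <-]|r _ [u _ <-]].
- by exists 0 => //; rewrite linear0.
- by exists (u + v) => //; rewrite linearD.
- by exists (r *: u) => //; rewrite linearZ.
Qed.

(* [combo xs W] is the submodule x_1 V + ... + x_n V + W. *)
Fixpoint combo xs W : set V :=
  if xs is x :: xs' then [set v | exists u, combo xs' W (v - x *: u)] else W.

Lemma is_submodule_combo xs W : is_submodule W -> is_submodule (combo xs W).
Proof.
move=> Ws; elim: xs => //= x xs IH; split=> [|u v [u' Hu] [v' Hv]|r v [v' Hv]].
- by exists 0; rewrite scaler0 subr0; apply: submod0.
- by exists (u' + v'); rewrite scalerDr opprD addrACA; apply: submodD.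
- exists (r *: v').
  by rewrite scalerA mulrC -scalerA -scalerBr; apply: submodZ.
Qed.

Lemma sub_combo xs W : W `<=` combo xs W.
Proof.
elim: xs => //= x xs IH v Wv.
by exists 0; rewrite scaler0 subr0; apply: IH.
Qed.

Lemma combo_gen xs W x v : is_submodule W -> x \in xs -> combo xs W (x *: v).
Proof.
move=> Ws; elim: xs => //= y xs IH; rewrite inE => /orP[/eqP<-|xxs].
  exists v; rewrite subrr.
  by apply: submod0; apply: is_submodule_combo.
by exists 0; rewrite scaler0 subr0; apply: IH.
Qed.

Lemma combo_min xs W N : is_submodule N -> W `<=` N ->
  (forall x v, x \in xs -> N (x *: v)) -> combo xs W `<=` N.
Proof.
move=> Ns WN; elim: xs => //= x xs IH xN v [u Hu].
apply: (@submodBl _ (x *: u)) => //; first by apply: xN; rewrite mem_head.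
by apply: IH Hu => y w yxs; apply: xN; rewrite inE yxs orbT.
Qed.

Lemma combo_subset xs ys W W' : is_submodule W' -> W `<=` W' ->
  {subset xs <= ys} -> combo xs W `<=` combo ys W'.
Proof.
move=> W's WW' xsys; apply: combo_min => [||x v /xsys].
- exact: is_submodule_combo.
- by move=> v /WW'; apply: sub_combo.
- exact: combo_gen.
Qed.

Lemma combo_cat xs ys W : combo (xs ++ ys) W = combo xs (combo ys W).
Proof. by elim: xs => //= x xs ->. Qed.

Lemma comboC xs ys W : is_submodule W ->
  combo xs (combo ys W) = combo ys (combo xs W).
Proof.
move=> Ws; rewrite -!combo_cat; apply/seteqP; split; apply: combo_subset => //.
- by move=> x; rewrite !mem_cat orbC.
- by move=> x; rewrite !mem_cat orbC.
Qed.

Definition pow_combo W ys n : set V := combo [seq y ^+ n | y <- ys] W.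

Lemma is_submodule_pow_combo W ys n :
  is_submodule W -> is_submodule (pow_combo W ys n).
Proof. exact: is_submodule_combo. Qed.

(** Multiplication by powers of the product of [ys] is the transition map of the direct system of
    quotients by the [pow_combo W ys n]; this makes it well defined. *)
Lemma pow_combo_raise W ys n k m : is_submodule W -> pow_combo W ys n m ->
  pow_combo W ys (n + k) ((\prod_(y <- ys) y) ^+ k *: m).
Proof.
move=> Ws; elim: ys m => [|y ys IH] m /=; first exact: submodZ.
move=> [u /IH Hu]; exists ((\prod_(x <- ys) x) ^+ k *: u).
rewrite big_cons; set P := \prod_(x <- ys) x in Hu *.
suff -> : (y * P) ^+ k *: m - y ^+ (n + k) *: (P ^+ k *: u) =
    y ^+ k *: (P ^+ k *: (m - y ^+ n *: u)).
  exact: submodZ (is_submodule_pow_combo _ _ Ws) Hu.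
rewrite !scalerBr !scalerA; congr (_ *: _ - _ *: _); rewrite ?exprMn //.
by rewrite exprD; ring.
Qed.

End Submodules.
Arguments pow_combo {R V} W ys n _.

Lemma combo_preimage (R : comPzRingType) (U V : lmodType R)
    (f : {linear U -> V}) (xs : seq R) (W : set V) :
  (forall v, exists u, f u = v) ->
  f @^-1` combo xs W = combo xs (f @^-1` W).
Proof.
move=> f_surj; elim: xs => //= x xs IH; apply/seteqP; split=> v /= [u].
  have [u' <-] := f_surj u => Hu; exists u'.
  by rewrite -IH /= linearB linearZ.
by rewrite -IH /= linearB linearZ => Hu; exists (f u).
Qed.

Section Ideals.
Variable R : comPzRingType.
Implicit Types (xs ys : seq R) (a : set R).

Lemma is_idealI a : a 0 -> (forall r s, a r -> a s -> a (r + s)) ->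
  (forall r s, a s -> a (r * s)) -> is_ideal a.
Proof. by []. Qed.

Lemma ideal0 a : is_ideal a -> a 0.
Proof. by case. Qed.

Lemma idealD a r s : is_ideal a -> a r -> a s -> a (r + s).
Proof. exact: (@submodD R R^o). Qed.

Lemma idealMl a r s : is_ideal a -> a s -> a (r * s).
Proof. exact: (@submodZ R R^o). Qed.

Lemma idealMr a r s : is_ideal a -> a r -> a (r * s).
Proof. by rewrite mulrC; apply: idealMl. Qed.

Lemma exprD_mod (r s : R) n : exists q, (r + s) ^+ n = r ^+ n + s * q.
Proof.
elim: n => [|n [q IH]]; first by exists 0; rewrite mulr0 addr0.
by exists (r * q + (r ^+ n + s * q)); rewrite !exprS IH; ring.
Qed.

Lemma gen_ideal_ideal xs : is_ideal (gen_ideal xs).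
Proof. exact: (@is_submodule_span R R^o). Qed.

Lemma gen_idealE xs : gen_ideal xs = @combo R R^o xs [set 0].
Proof.
apply/seteqP; split.
  apply: (@span_min R R^o) => [|x /= xxs].
    by apply: is_submodule_combo; apply: is_submodule0.
  rewrite -[x]mulr1.
  by apply: (@combo_gen R R^o) => //; apply: is_submodule0.
apply: (@combo_min R R^o) => [|v ->|x v xxs]; first exact: gen_ideal_ideal.
  exact: ideal0 (gen_ideal_ideal _).
apply: (@idealMr (gen_ideal xs) x v); first exact: gen_ideal_ideal.
exact: (@sub_span R R^o [set` xs]).
Qed.

Lemma mem_gen_ideal xs x : x \in xs -> gen_ideal xs x.
Proof. by move=> xxs; apply: (@sub_span R R^o). Qed.

Lemma gen_ideal_min xs a :
  is_ideal a -> [set` xs] `<=` a -> gen_ideal xs `<=` a.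
Proof. by move=> aI xsa; apply: (@span_min R R^o). Qed.

Lemma gen_ideal_subset xs ys : {subset xs <= ys} ->
  gen_ideal xs `<=` gen_ideal ys.
Proof.
move=> s; apply: gen_ideal_min; first exact: gen_ideal_ideal.
by move=> x /= /s; apply: mem_gen_ideal.
Qed.

Lemma gen_ideal_cat xs ys r : gen_ideal (xs ++ ys) r ->
  exists s t, [/\ gen_ideal xs s, gen_ideal ys t & r = s + t].
Proof.
have sub0 := @is_submodule0 R R^o.
rewrite gen_idealE combo_cat -!gen_idealE.
suff : @combo R R^o xs (gen_ideal ys) `<=` [set r | exists s t,
    [/\ gen_ideal xs s, gen_ideal ys t & r = s + t]] by apply.
apply: (@combo_min R R^o) => [|t yst|x v xxs].
- apply: is_idealI => [|_ _ [s [t [Hs Ht ->]]] [s' [t' [Hs' Ht' ->]]]|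
                        k _ [s [t [Hs Ht ->]]]].
  + exists 0, 0; rewrite addr0; split=> //.
      exact: ideal0 (gen_ideal_ideal _).
    exact: ideal0 (gen_ideal_ideal _).
  + exists (s + s'), (t + t'); rewrite addrACA; split=> //.
      exact: idealD (gen_ideal_ideal _) Hs Hs'.
    exact: idealD (gen_ideal_ideal _) Ht Ht'.
  + exists (k * s), (k * t); rewrite -mulrDr; split=> //.
      exact: idealMl (gen_ideal_ideal _) Hs.
    exact: idealMl (gen_ideal_ideal _) Ht.
- exists 0, t; rewrite add0r; split=> //.
  exact: ideal0 (gen_ideal_ideal _).
- exists (x * v), 0; rewrite addr0; split=> //.
    exact: idealMr (gen_ideal_ideal _) (mem_gen_ideal xxs).
  exact: ideal0 (gen_ideal_ideal _).
Qed.

Lemma gen_ideal_scale (V : lmodType R) (N : set V) xs r v : is_submodule N ->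
  (forall x, x \in xs -> N (x *: v)) -> gen_ideal xs r -> N (r *: v).
Proof.
move=> Ns xN; move: r; apply: gen_ideal_min => [|x /= /xN //].
apply: is_idealI => /= [|r s|r s]; first by rewrite scale0r; apply: submod0.
  by rewrite scalerDl; apply: submodD.
by rewrite -scalerA; apply: submodZ.
Qed.

Lemma smul_gen_idealE (V : lmodType R) xs :
  smul (gen_ideal xs) [set: V] = combo xs [set 0].
Proof.
have sub0 := @is_submodule0 R V; apply/seteqP; split.
  apply: span_min => [|_ [r xsr [v _ <-]]]; first exact: is_submodule_combo.
  apply: gen_ideal_scale xsr => [|x xxs]; first exact: is_submodule_combo.
  exact: combo_gen.
apply: combo_min => [|v ->|x v xxs]; first exact: is_submodule_span.
  by apply: submod0; apply: is_submodule_span.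
by apply: sub_span; exists x; [apply: mem_gen_ideal|exists v].
Qed.

Lemma is_submodule_annihilated (V : lmodType R) (r : R) :
  is_submodule [set v : V | r *: v = 0].
Proof.
split=> [|u v /= Hu Hv|s v /= Hv]; first by rewrite /= scaler0.
  by rewrite scalerDr Hu Hv addr0.
by rewrite scalerA mulrC -scalerA Hv scaler0.
Qed.

End Ideals.

Section QuotientMap.
Variables (R : comPzRingType) (V : lmodType R) (N : set V).

Definition qpi (v : V) : quot_mod N := (\pi_(quot_mod N) v)%qT.

Fact qpi_linear : linear qpi.
Proof.
move=> r u v; apply/esym.
rewrite [LHS](congr1 (fun z => quot_add z _) (pi_quot_scale N r u)).
exact: pi_quot_add.
Qed.

HB.instance Definition _ := GRing.isLinear.Build R V (quot_mod N) _ qpi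
  qpi_linear.

Lemma qpi_surj (q : quot_mod N) : exists v, qpi v = q.
Proof. by exists (repr q); apply: reprK. Qed.

Lemma qpi_eq0 v : qpi v = 0 <-> submodule_span N v.
Proof.
by rewrite -[v in submodule_span N v]subr0; apply: (@quot_modP R V N v 0).
Qed.

Lemma qpi_ker : is_submodule N -> forall v, qpi v = 0 <-> N v.
Proof.
by move=> Ns v; rewrite -[X in _ <-> X v](span_id Ns); apply: qpi_eq0.
Qed.

End QuotientMap.
Arguments qpi {R V} N v.

Lemma quotient_lift (R : comPzRingType) (U V : lmodType R) (N : set U)
    (f : {linear U -> V}) : is_submodule N -> (forall u, N u -> f u = 0) ->
  exists g : {linear quot_mod N -> V}, forall u, g (qpi N u) = f u.
Proof.
move=> Ns Nf; pose g (q : quot_mod N) := f (repr q).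
have gE u : g (qpi N u) = f u.
  apply/eqP; rewrite -subr_eq0 -linearB; apply/eqP/Nf.
  by have := @quot_repr _ _ N u; rewrite [submodule_span N]span_id.
have g_lin : linear g.
  move=> r p q; have [v <-] := qpi_surj p; have [w <-] := qpi_surj q.
  by rewrite -linearP !gE linearP.
pose gL : {linear quot_mod N -> V} :=
  HB.pack g (GRing.isLinear.Build R (quot_mod N) V _ g g_lin).
by exists gL.
Qed.

(** * Torsion and injective modules *)

Lemma seq_bound (T : eqType) (P : T -> nat -> Prop) (s : seq T) :
  (forall t m n, (m <= n)%N -> P t m -> P t n) ->
  (forall t, t \in s -> exists n, P t n) ->
  exists n, forall t, t \in s -> P t n.
Proof.
move=> P_mono; elim: s => [|t s IH] Ps; first by exists 0%N.
have [n sn] : exists n, forall t, t \in s -> P t n.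
  by apply: IH => u us; apply: Ps; rewrite inE us orbT.
have [m tm] := Ps t (mem_head t s).
exists (maxn m n) => u; rewrite inE => /predU1P[->|/sn].
  by apply: P_mono tm; apply: leq_maxl.
by apply: P_mono; apply: leq_maxr.
Qed.

Section Torsion.
Variable R : comPzRingType.
Implicit Types (V : lmodType R) (xs ys : seq R) (x : R).

(* This is Gamma_<xs>(V), see [Gamma_gen_ideal]. *)
Definition torsion V xs : set V :=
  [set v | forall x, x \in xs -> exists n, x ^+ n *: v = 0].

Lemma expr_scale0_le V x (v : V) m n :
  (m <= n)%N -> x ^+ m *: v = 0 -> x ^+ n *: v = 0.
Proof. by move=> /subnK <- xv; rewrite exprD -scalerA xv scaler0. Qed.

Lemma torsion_bound V xs (v : V) : @torsion V xs v ->
  exists n, forall x, x \in xs -> x ^+ n *: v = 0.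
Proof.
by move=> xv; apply: (seq_bound _ xv) => x m n; apply: expr_scale0_le.
Qed.

Lemma is_submodule_torsion V xs : is_submodule (@torsion V xs).
Proof.
split=> [x _|u v Hu Hv x xxs|r v Hv x xxs].
- by exists 0%N; rewrite scaler0.
- have [[m um] [n vn]] := (Hu x xxs, Hv x xxs); exists (m + n)%N.
  by rewrite scalerDr exprD mulrC -{1}scalerA um [X in X *: v]mulrC -scalerA
             vn !scaler0 addr0.
- have [n vn] := Hv x xxs; exists n.
  by rewrite scalerA mulrC -scalerA vn scaler0.
Qed.

Lemma torsion_linear V (W : lmodType R) xs (f : {linear V -> W}) v :
  @torsion V xs v -> @torsion W xs (f v).
Proof.
move=> Hv x /Hv[n vn]; exists n; by rewrite -linearZ vn linear0.
Qed.

Lemma torsion_subset V xs ys : {subset xs <= ys} ->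
  @torsion V ys `<=` @torsion V xs.
Proof. by move=> xsys v Hv x /xsys; apply: Hv. Qed.

Lemma torsion_cons V x xs v : @torsion V (x :: xs) v <->
  @torsion V xs v /\ exists n, x ^+ n *: v = 0.
Proof.
split=> [Hv|[Hv [n vn]] y].
  split; last by apply: Hv; apply: mem_head.
  by move: Hv; apply: torsion_subset => y; rewrite inE orbC => ->.
by rewrite inE => /predU1P[->|/Hv //]; exists n.
Qed.

(* Pigeonhole: in every monomial of degree N + 1 some generator x occurs *)
(* with exponent at least n x. *)
Lemma ideal_exp_kills V xs (n : R -> nat) N (v : V) :
  (\sum_(x <- xs) n x <= N)%N -> (forall x, x \in xs -> x ^+ n x *: v = 0) ->
  forall r, ideal_exp (gen_ideal xs) N.+1 r -> r *: v = 0.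
Proof.
have step N' (w : V) : (forall x r, x \in xs ->
    ideal_exp (gen_ideal xs) N' r -> r *: (x *: w) = 0) ->
    forall r, ideal_exp (gen_ideal xs) N'.+1 r -> r *: w = 0.
  move=> Hw; apply: (@span_min R R^o) => [|_ [r xsr [s Hs <-]]].
    apply: is_idealI => /= [|r s Hr Hs|r s Hs]; first by rewrite scale0r.
      by rewrite scalerDl Hr Hs addr0.
    by rewrite -scalerA Hs scaler0.
  have := gen_ideal_scale (is_submodule_annihilated V s) _ xsr.
  move=> /(_ w) /=; rewrite scalerA mulrC; apply=> x xxs.
  by rewrite Hw.
elim: N n v => [|N IH] n v; last first.
  move=> nN xv; apply: step => x r xxs.
  have [nx0|nx_gt0] := posnP (n x).
    by move: (xv x xxs); rewrite nx0 scale1r => ->; rewrite !scaler0.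
  (* The exponents [n'] kill x v and have a smaller sum, so the induction hypothesis applies to x
     v. *)
  pose n' y := if y == x then (n x).-1 else n y.
  have n'_le y : (n' y <= n y)%N.
    by rewrite /n'; case: eqP => // ->; apply: leq_pred.
  have n'_lt s : x \in s -> (\sum_(y <- s) n' y < \sum_(y <- s) n y)%N.
    elim: s => // y s IHs; rewrite inE !big_cons => /predU1P[<-|/IHs lt_s].
      rewrite {1}/n' eqxx -addSn prednK // leq_add2l.
      by apply: leq_sum => u _; apply: n'_le.
    by rewrite -addnS leq_add.
  move: r; apply: (IH n') => [|y yxs].
    by rewrite -ltnS; apply: leq_trans nN; apply: n'_lt.
  rewrite /n'; case: eqP => [->|_].
    by rewrite scalerA -exprSr prednK // xv.
  by rewrite scalerA mulrC -scalerA xv ?scaler0.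
rewrite leqn0 => sum0 xv; apply: step => x r xxs _.
have /eqP n0 : n x == 0%N.
  by move: sum0; rewrite sum_nat_seq_eq0 => /allP/(_ x xxs).
by have := xv x xxs; rewrite n0 scale1r => ->; rewrite !scaler0.
Qed.

Lemma ideal_exp_expr (I : set R) r n : I r -> ideal_exp I n (r ^+ n).
Proof.
move=> Ir; elim: n => [//|n IH]; rewrite exprS.
by apply: (@sub_span R R^o); exists r => //; exists (r ^+ n).
Qed.

Lemma Gamma_gen_ideal V xs : Gamma (gen_ideal xs) V = @torsion V xs.
Proof.
apply/seteqP; split=> [v [t _ Hv] x xxs|v Hv].
  by exists t; apply: Hv; apply: ideal_exp_expr; apply: mem_gen_ideal.
have [n xn] := torsion_bound Hv.
exists (\sum_(x <- xs) n).+1 => //.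
exact: (@ideal_exp_kills V xs (fun=> n)).
Qed.

End Torsion.
Arguments torsion {R V} xs v.

(** The colon ideals B : x^n increase with n. Their union C is finitely generated, so one exponent
    serves all its generators. *)
Lemma noetherian_colon (R : comPzRingType) (B : set R) (x : R) :
  noetherian R -> is_ideal B ->
  exists k, forall n r, B (x ^+ n * r) -> B (x ^+ k * r).
Proof.
move=> R_noeth B_ideal; pose C := [set r | exists n, B (x ^+ n * r)].
have B_le m n r : (m <= n)%N -> B (x ^+ m * r) -> B (x ^+ n * r).
  by move=> /subnK <- Br; rewrite exprD -mulrA; apply: idealMl.
have C_ideal : is_ideal C.
  apply: is_idealI => [|r s [m Br] [n Bs]|r s [n Bs]].
  - by exists 0%N; rewrite mulr0; apply: ideal0.
  - exists (maxn m n); rewrite mulrDr; apply: idealD => //.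
      by apply: B_le Br; apply: leq_maxl.
    by apply: B_le Bs; apply: leq_maxr.
  - by exists n; rewrite mulrCA; apply: idealMl.
have [ys CE] := R_noeth C C_ideal.
have [k Bk] : exists k, forall y, y \in ys -> B (x ^+ k * y).
  apply: (seq_bound (P := fun y k => B (x ^+ k * y))) => [y m n|y yys].
    exact: B_le.
  by have : C y by rewrite CE; apply: mem_gen_ideal.
exists k => n r Br; have : C r by exists n.
rewrite CE; move: r {Br}; apply: gen_ideal_min => [|y /= /Bk //].
apply: is_idealI => /= [|r s Br Bs|r s Bs].
  by rewrite mulr0; apply: ideal0.
  by rewrite mulrDr; apply: idealD.
by rewrite mulrCA; apply: idealMl.
Qed.

Section InjectiveModules.
Variable R : comPzRingType.
Implicit Types (E U V : lmodType R).

(** Both maps factor through U / ker f, on which f becomes injective. *)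
Lemma injective_extend E U V (f : {linear U -> V}) (g : {linear U -> E}) :
  injective_module E -> (forall u, f u = 0 -> g u = 0) ->
  exists h : {linear V -> E}, forall u, h (f u) = g u.
Proof.
move=> E_inj fg; pose K := f @^-1` [set 0].
have K_sub : is_submodule K.
  by apply: is_submodule_preimage; apply: is_submodule0.
have [f' f'E] := quotient_lift K_sub (fun u Ku => Ku : f u = 0).
have [g' g'E] := quotient_lift K_sub fg.
have f'_inj : injective f'.
  move=> p q; have [u <-] := qpi_surj p; have [v <-] := qpi_surj q.
  rewrite !f'E => /eqP; rewrite -subr_eq0 -linearB => /eqP Kuv.
  by apply/eqP; rewrite -subr_eq0 -linearB; apply/eqP/(qpi_ker K_sub).
have [h hE] := E_inj _ _ f' g' f'_inj.
by exists h => u; rewrite -f'E hE g'E.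
Qed.

Definition orbit_map V (v : V) (r : R^o) : V := r *: v.

Fact orbit_map_linear V (v : V) : linear (orbit_map v).
Proof. by move=> r s t; rewrite /orbit_map scalerDl scalerA. Qed.

HB.instance Definition _ V v :=
  GRing.isLinear.Build R R^o V _ (@orbit_map V v) (@orbit_map_linear V v).

(* For injective E the map E -> E_x is onto, compatibly with torsion; this is *)
(* what makes 0 -> Gamma_(x,xs) -> Gamma_xs -> (Gamma_xs)_x -> 0 exact on E. *)
Lemma injective_quasi_divisible E xs x n (z : E) :
  noetherian R -> injective_module E -> torsion xs z ->
  exists w k, torsion xs w /\ x ^+ (n + k) *: w = x ^+ k *: z.
Proof.
move=> R_noeth E_inj /torsion_bound[N xsz].
pose J := gen_ideal [seq y ^+ N | y <- xs].
have J_ideal : is_ideal J by apply: gen_ideal_ideal.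
have Jz r : J r -> r *: z = 0.
  apply: (gen_ideal_scale (is_submodule0 E)) => _ /mapP[y yxs ->] /=.
  exact: xsz.
have B_ideal : is_ideal [set r | r *: z = 0].
  apply: is_idealI => /= [|r s Hr Hs|r s Hs]; first by rewrite scale0r.
    by rewrite scalerDl Hr Hs addr0.
  by rewrite -scalerA Hs scaler0.
(* For this k, r x^(n+k) in J forces r x^k z = 0. Hence x^(n+k) |-> x^k z is well defined on a
   submodule of R / J; it extends to R / J, and w is the image of 1, which J kills. *)
have [k Hk] := noetherian_colon x R_noeth B_ideal.
pose one : quot_mod (J : set R^o) := qpi _ (1 : R^o).
have oneE r : r *: one = qpi _ (r : R^o).
  by rewrite -linearZ [r *: _]mulr1.
have [h hE] : exists h : {linear quot_mod (J : set R^o) -> E}, forall r : R^o,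
    h (orbit_map (x ^+ (n + k) *: one) r) = orbit_map (x ^+ k *: z) r.
  apply: injective_extend => // r; rewrite /= /orbit_map !scalerA oneE.
  move=> /(@qpi_ker R R^o J J_ideal) /Jz; rewrite mulrC => /Hk /=.
  by rewrite mulrC.
exists (h one), k; split.
  move=> y yxs; exists N; rewrite -linearZ oneE.
  rewrite ((@qpi_ker R R^o J J_ideal _).2 _) ?linear0 //.
  by apply: mem_gen_ideal; apply: map_f.
by have := hE 1; rewrite /= /orbit_map !scale1r linearZ.
Qed.

End InjectiveModules.

(** * Radicals modulo the annihilator *)

Section Radicals.
Variables (R : comPzRingType) (M : lmodType R).
Implicit Types (J : set R) (xs ys : seq R).

Lemma radical_mod_ann_subset (a b : set R) : a `<=` b ->
  radical_mod_ann M a `<=` radical_mod_ann M b.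
Proof.
by move=> ab r [n [s /ab bs [t tM stE]]]; exists n, s => //; exists t.
Qed.

Lemma radical_mod_ann_id (a : set R) : a `<=` radical_mod_ann M a.
Proof.
move=> r ar; exists 1%N, r => //; exists 0; last by rewrite addr0.
by move=> m; rewrite scale0r.
Qed.

Lemma is_ideal_ann : is_ideal (ann M).
Proof.
apply: is_idealI => [m|r s rM sM m|r s sM m]; first by rewrite scale0r.
  by rewrite scalerDl rM sM addr0.
by rewrite -scalerA sM scaler0.
Qed.

Lemma is_ideal_add_ann J : is_ideal J ->
  is_ideal [set x + y | x in J & y in ann M].
Proof.
move=> J_ideal; have A_ideal := is_ideal_ann.
apply: is_idealI => [|_ _ [r Jr [a aM <-]] [s Js [b bM <-]]|
                      r _ [s Js [b bM <-]]].
- exists 0; first exact: ideal0.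
  by exists 0; [exact: ideal0|rewrite addr0].
- exists (r + s); first exact: idealD Jr Js.
  by exists (a + b); [exact: idealD aM bM|rewrite addrACA].
- exists (r * s); first exact: idealMl Js.
  by exists (r * b); [exact: idealMl bM|rewrite mulrDr].
Qed.

(** The class of 1 in R / J is torsion for [xs], so by [Gamma_gen_ideal] a power of <xs> kills
    it. *)
Lemma radical_gen_ideal J xs : is_ideal J ->
  (forall x, x \in xs -> exists n, J (x ^+ n)) ->
  forall r, gen_ideal xs r -> exists n, J (r ^+ n).
Proof.
move=> J_ideal xsJ r xs_r; pose one := qpi (J : set R^o) (1 : R^o).
have oneE s : s *: one = 0 <-> J s.
  rewrite -linearZ_LR [s *: _]mulr1; exact: (@qpi_ker R R^o J J_ideal).
have : torsion xs one by move=> x /xsJ[n Jxn]; exists n; apply/oneE.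
rewrite -Gamma_gen_ideal => -[t _ t_one].
by exists t; apply/oneE/t_one; apply: ideal_exp_expr.
Qed.

Lemma radical_mod_ann_gen J xs : is_ideal J ->
  [set` xs] `<=` radical_mod_ann M J ->
  radical_mod_ann M (gen_ideal xs) `<=` radical_mod_ann M J.
Proof.
move=> J_ideal xsJ r [n [s xs_s [b bM sbE]]].
have J'_ideal := is_ideal_add_ann J_ideal.
have [m [s' Js' [b' b'M s'E]]] := radical_gen_ideal J'_ideal xsJ xs_s.
have [q qE] := exprD_mod s b m.
exists (n * m)%N, s' => //; exists (b' + b * q).
  exact: idealD is_ideal_ann b'M (idealMr q is_ideal_ann bM).
by rewrite exprM -sbE qE -s'E addrA.
Qed.

Lemma same_radical_gen xs ys :
  [set` xs] `<=` radical_mod_ann M (gen_ideal ys) ->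
  [set` ys] `<=` radical_mod_ann M (gen_ideal xs) ->
  same_radical M (gen_ideal xs) (gen_ideal ys).
Proof.
by move=> xsys ysxs; apply/seteqP; split; apply: radical_mod_ann_gen => //;
  apply: gen_ideal_ideal.
Qed.

Lemma radical_mod_annP J r : radical_mod_ann M J r <->
  exists n s, J s /\ ann M (r ^+ n - s).
Proof.
split=> [[n [s Js [b bM sbE]]]|[n [s [Js rsM]]]].
  by exists n, s; split=> //; rewrite -sbE addrAC subrr add0r.
by exists n, s => //; exists (r ^+ n - s) => //; rewrite addrC subrK.
Qed.

End Radicals.

(** * Local cohomology *)

Section Cohomology.
Variables (R : comPzRingType) (M : lmodType R) (I : injective_resolution M).
Implicit Types (xs ys : seq R) (x y : R) (i j n : nat).

Local Notation d i := (res_diff I i).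

Lemma res_diff_aug m : d 0 (res_aug I m) = 0.
Proof.
by have /seteqP[_ sub] := res_exact0 I; apply: sub; exists m.
Qed.

Lemma res_diff_diff i z : d i.+1 (d i z) = 0.
Proof. by have /seteqP[_ sub] := res_exactS I i; apply: sub; exists z. Qed.

Lemma res_exact i z : d i.+1 z = 0 -> exists w, d i w = z.
Proof. by have /seteqP[sub _] := res_exactS I i => /sub[w _ <-]; exists w. Qed.

Definition cobound xs i : set (I i) :=
  match i return set (I i) with
  | 0%N => [set 0]
  | j.+1 => d j @` torsion xs
  end.

Arguments cobound : clear implicits.

Definition cocycle xs i : set (I i) := [set z | torsion xs z /\ d i z = 0].

Arguments cocycle xs {i} _.

(** H^i_<xs>(M) = 0, computed on the fixed resolution I. *)
Definition lc_vanish xs i : Prop := @cocycle xs i `<=` cobound xs i.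

Lemma lc_vanishE xs i : lc_vanish xs i <->
  lc_cocycle (gen_ideal xs) I i `<=` lc_coboundary (gen_ideal xs) I i.
Proof.
rewrite /lc_vanish /lc_cocycle /lc_coboundary Gamma_gen_ideal.
by case: i => [//|j]; rewrite Gamma_gen_ideal.
Qed.

Lemma is_submodule_cobound xs i : is_submodule (cobound xs i).
Proof.
case: i => [|j] /=; first exact: is_submodule0.
split=> [|_ _ [u xu <-] [v xv <-]|r _ [v xv <-]].
- exists 0; last by rewrite linear0.
  exact: submod0 (@is_submodule_torsion _ _ _).
- exists (u + v); last by rewrite linearD.
  exact: submodD (@is_submodule_torsion _ _ _) xu xv.
- exists (r *: v); last by rewrite linearZ_LR.
  exact: submodZ (@is_submodule_torsion _ _ _) xv.
Qed.

Lemma is_submodule_cocycle xs i : is_submodule (@cocycle xs i).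
Proof.
have Ts := @is_submodule_torsion _ (I i) xs.
split=> [|u v [xu du] [xv dv]|r v [xv dv]]; split.
- exact: submod0 Ts.
- by rewrite linear0.
- exact: submodD Ts xu xv.
- by rewrite linearD du dv addr0.
- exact: submodZ Ts xv.
- by rewrite linearZ_LR dv scaler0.
Qed.

Lemma sub_cobound_cocycle xs i : cobound xs i `<=` @cocycle xs i.
Proof.
case: i => [|j] z /=.
  by move=> ->; apply: submod0 (@is_submodule_cocycle _ _).
move=> [w xw <-]; split; last exact: res_diff_diff.
exact: torsion_linear.
Qed.

Lemma cobound_subset xs ys i : {subset xs <= ys} ->
  cobound ys i `<=` cobound xs i.
Proof.
case: i => [|j] xsys z; first by [].
move=> [w yw <-]; by exists w => //; apply: torsion_subset yw.
Qed.

Hypothesis R_noeth : noetherian R.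

(** If d u = x^n w with u torsion, quasi-divisibility gives u' with x^(n+k) u' = x^k u, and d u'
    agrees with w up to x-torsion. *)
Lemma cobound_divide xs i x n (w : I i) : cobound xs i (x ^+ n *: w) ->
  exists2 w', cobound xs i w' & exists p, x ^+ p *: (w - w') = 0.
Proof.
case: i w => [|j] w /=.
  by move=> xw; exists 0 => //; exists n; rewrite subr0.
move=> [u xu du].
have [u' [k [xu' u'E]]] :=
  injective_quasi_divisible x n R_noeth (res_inj (i:=j)) xu.
exists (d j u'); first by exists u'.
exists (n + k)%N; rewrite scalerBr -linearZ_LR u'E linearZ_LR du scalerA -exprD.
by rewrite addnC subrr.
Qed.

(** The localisation of H^i_<xs>(M) at x vanishes. *)
Definition acts_nilpotently x xs i : Prop :=
  forall z, cocycle xs z -> exists n, cobound xs i (x ^+ n *: z).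

(** In the long exact sequence, H^(i+1)_(x,xs) -> H^(i+1)_xs is injective when the localisation of
    H^i_xs at x vanishes. *)
Lemma cobound_cons x xs i (z : I i.+1) : acts_nilpotently x xs i ->
  cocycle (x :: xs) z -> cobound xs i.+1 z -> cobound (x :: xs) i.+1 z.
Proof.
move=> x_nil [/torsion_cons[xz [m xmz]] _] [w xw dw].
have [n] : exists n, cobound xs i (x ^+ n *: (x ^+ m *: w)).
  apply: x_nil; split; first exact: submodZ (@is_submodule_torsion _ _ _) xw.
  by rewrite linearZ_LR dw.
rewrite scalerA -exprD => /cobound_divide[w' cob_w' [p xpw]].
have [xw' dw'] := sub_cobound_cocycle cob_w'.
exists (w - w'); last by rewrite linearB dw dw' subr0.
apply/torsion_cons; split; last by exists p.
exact: submodB (@is_submodule_torsion _ _ _) xw xw'.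
Qed.

(** Under the same hypothesis H^i_(x,xs) -> H^i_xs is onto: every cocycle is, up to a coboundary,
    x-torsion. *)
Lemma cobound_uncons x xs i : acts_nilpotently x xs i ->
  lc_vanish (x :: xs) i -> lc_vanish xs i.
Proof.
move=> x_nil van z z_coc; have [n] := x_nil z z_coc.
move=> /cobound_divide[w cob_w [p xpw]].
have w_coc := sub_cobound_cocycle cob_w.
rewrite -(subrK w z); apply: submodD cob_w.
  exact: (@is_submodule_cobound xs i).
apply: (@cobound_subset xs (x :: xs)) => [y yxs|].
  by rewrite inE yxs orbT.
have [xzw dzw] := submodB (@is_submodule_cocycle _ _) z_coc w_coc.
by apply: van; split=> //; apply/torsion_cons; split=> //; exists p.
Qed.

(** For the empty sequence the torsion complex is I itself, exact in positive degrees; each added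
    element raises the top degree by at most one. *)
Lemma lc_vanish_gt_size xs i : (size xs < i)%N -> lc_vanish xs i.
Proof.
elim: xs i => [|x xs IH] [//|i] /=.
  by move=> _ z [_ /res_exact[w <-]]; exists w.
rewrite ltnS => lt_xs z z_coc; apply: cobound_cons => // [w w_coc|].
  by exists 0%N; rewrite scale1r; apply: IH.
apply: IH; first exact: ltnW.
by case: z_coc => /torsion_cons[].
Qed.

(* Multiplication by b lifts the zero map of M to I, hence is null-homotopic; *)
(* the homotopy is only built up to the degree needed.                        *)
Lemma ann_null_homotopic b i : ann M b ->
  exists s : {linear I i.+1 -> I i},
    forall xs z, torsion xs z -> cobound xs i (b *: z - s (d i z)).
Proof.
move=> bM; elim: i => [|i [s sE]].
  have [s sE] : exists s : {linear I 1 -> I 0},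
      forall z, s (d 0 z) = (b \*: idfun : {linear I 0 -> I 0}) z.
    apply: injective_extend; first exact: res_inj.
    have /seteqP[sub _] := res_exact0 I => z /sub[m _ <-] /=.
    by rewrite -linearZ_LR bM linear0.
  by exists s => xs z _ /=; rewrite sE /= subrr.
have [t tE] : exists t : {linear I i.+2 -> I i.+1},
    forall z, t (d i.+1 z) =
      ((b \*: idfun) \- (d i \o s) : {linear I i.+1 -> I i.+1}) z.
  apply: injective_extend; first exact: res_inj.
  move=> z /res_exact[w <-] /=; rewrite -linearZ_LR -linearB.
  by have [|_ ->] := @sub_cobound_cocycle [::] i _ (sE _ w _).
exists t => xs z xz /=; exists (s z); first exact: torsion_linear.
by rewrite tE /= opprB addrCA subrr addr0.
Qed.

Lemma ann_cobound b xs i z : ann M b -> cocycle xs z -> cobound xs i (b *: z).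
Proof.
move=> bM [xz dz]; have [s sE] := ann_null_homotopic i bM.
by have := sE _ _ xz; rewrite dz linear0 subr0.
Qed.

(** A power of x is s + b with s in <xs> and b in Ann M. A power of s kills the given cocycle, and b
    sends cocycles to coboundaries. *)
Lemma radical_acts_nilpotently x xs i :
  radical_mod_ann M (gen_ideal xs) x -> acts_nilpotently x xs i.
Proof.
move=> [n [s xs_s [b bM sbE]]] z z_coc.
have [xz _] := z_coc; move: xz; rewrite -Gamma_gen_ideal => -[t _ tz].
exists (n * t)%N; rewrite exprM -sbE.
have [q ->] := exprD_mod s b t.
rewrite scalerDl tz; last exact: ideal_exp_expr.
rewrite add0r -scalerA; apply: ann_cobound => //.
exact: submodZ (@is_submodule_cocycle _ _) z_coc.
Qed.

Lemma lc_vanish_cons x xs i : radical_mod_ann M (gen_ideal xs) x ->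
  lc_vanish (x :: xs) i <-> lc_vanish xs i.
Proof.
move=> x_rad; split; first exact/cobound_uncons/radical_acts_nilpotently.
move=> van z z_coc; have cob_z : cobound xs i z.
  by apply: van; case: z_coc => /torsion_cons[].
case: i z z_coc cob_z {van} => [//|i] z z_coc; apply: cobound_cons => //.
exact: radical_acts_nilpotently.
Qed.

Lemma lc_vanish_eq_mem xs ys i : xs =i ys -> lc_vanish xs i -> lc_vanish ys i.
Proof.
move=> xsys van z [yz dz]; apply: (@cobound_subset ys xs) => [x|].
  by rewrite xsys.
by apply: van; split=> //; apply: torsion_subset yz => x; rewrite xsys.
Qed.

Lemma lc_vanish_cat xs ys i : [set` ys] `<=` radical_mod_ann M (gen_ideal xs) ->
  lc_vanish (ys ++ xs) i <-> lc_vanish xs i.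
Proof.
elim: ys => //= y ys IH ysrad; rewrite -IH => [|x /= xys].
  apply: lc_vanish_cons; apply: radical_mod_ann_subset (ysrad y _).
    by apply: gen_ideal_subset => x; rewrite mem_cat orbC => ->.
  by rewrite /= mem_head.
by apply: ysrad; rewrite /= inE xys orbT.
Qed.

(** Elements of the radical can be adjoined one at a time without affecting vanishing, so both sides
    are compared with the concatenation. *)
Lemma same_radical_lc_vanish xs ys i :
  same_radical M (gen_ideal xs) (gen_ideal ys) ->
  lc_vanish xs i <-> lc_vanish ys i.
Proof.
move=> rad_eq; rewrite -(@lc_vanish_cat xs ys) => [|y yys].
  rewrite -(@lc_vanish_cat ys xs) => [|x xxs].
    split; apply: lc_vanish_eq_mem => x; by rewrite !mem_cat orbC.
  by rewrite -rad_eq; apply: radical_mod_ann_id; apply: mem_gen_ideal.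
by rewrite rad_eq; apply: radical_mod_ann_id; apply: mem_gen_ideal.
Qed.

(* The cocycle z represents the image of m / (prod ys)^n under the iterated   *)
(* connecting maps of the sequences                                           *)
(* 0 -> Gamma_(y :: ys)(I) -> Gamma_ys(I) -> Gamma_ys(I)_y -> 0.              *)
Fixpoint represents ys n m : set (I (size ys)) :=
  match ys return set (I (size ys)) with
  | [::] => [set res_aug I m]
  | y :: ys' => [set z | exists z' w k, [/\ @represents ys' n m z',
      torsion ys' w, y ^+ (n + k) *: w = y ^+ k *: z' & z = d (size ys') w]]
  end.

Arguments represents : clear implicits.

Lemma represents_cocycle ys n m z : represents ys n m z -> cocycle ys z.
Proof.
elim: ys n m z => [|y ys IH] n m z /=.
  by move=> ->; split=> //; apply: res_diff_aug.
move=> [z' [w [k [/IH[_ dz'] yw wE ->]]]]; split; last exact: res_diff_diff.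
apply/torsion_cons; split; first exact: torsion_linear.
by exists (n + k)%N; rewrite -linearZ_LR wE linearZ_LR dz' scaler0.
Qed.

Lemma represents_exists ys n m : exists z, represents ys n m z.
Proof.
elim: ys => [|y ys [z' z'E]]; first by exists (res_aug I m).
have [yz' _] := represents_cocycle z'E.
have [w [k [yw wE]]] :=
  injective_quasi_divisible y n R_noeth (res_inj (i:=size ys)) yz'.
by exists (d _ w), z', w, k.
Qed.

Lemma representsD ys n m1 m2 z1 z2 : represents ys n m1 z1 ->
  represents ys n m2 z2 -> represents ys n (m1 + m2) (z1 + z2).
Proof.
elim: ys z1 z2 => [|y ys IH] z1 z2 /=; first by move=> -> ->; rewrite linearD.
move=> [z1' [w1 [k1 [z1E yw1 w1E ->]]]] [z2' [w2 [k2 [z2E yw2 w2E ->]]]].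
exists (z1' + z2'), (w1 + w2), (k1 + k2)%N; split; last by rewrite linearD.
- exact: IH.
- exact: submodD (@is_submodule_torsion _ _ _) yw1 yw2.
- rewrite !scalerDr; congr (_ + _).
    by rewrite addnA [in LHS]addnC exprD -scalerA w1E scalerA -exprD addnC.
  by rewrite addnCA exprD -scalerA w2E scalerA -exprD.
Qed.

Lemma representsZ ys n r m z :
  represents ys n m z -> represents ys n (r *: m) (r *: z).
Proof.
elim: ys z => [|y ys IH] z /=; first by move=> ->; rewrite linearZ_LR.
move=> [z' [w [k [zE yw wE ->]]]].
exists (r *: z'), (r *: w), k; split; last by rewrite linearZ_LR.
- exact: IH.
- exact: submodZ (@is_submodule_torsion _ _ _) yw.
- by rewrite scalerA mulrC -scalerA wE scalerA mulrC scalerA.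
Qed.

(** With P the product of [ys], m / P^n = P^k m / P^(n+k). *)
Lemma represents_raise ys n k m z : represents ys n m z ->
  represents ys (n + k) ((\prod_(y <- ys) y) ^+ k *: m) z.
Proof.
elim: ys m z => [|y ys IH] m z /=; first by rewrite big_nil expr1n scale1r.
move=> [z' [w [l [zE yw wE ->]]]].
exists (y ^+ k *: z'), w, l; split=> //.
  by rewrite big_cons exprMn mulrC -scalerA; apply/IH/representsZ.
by rewrite addnAC exprD mulrC -scalerA wE !scalerA mulrC.
Qed.

(** The connecting map into the top degree is onto because H_ys vanishes in degree [size ys] + 1. *)
Lemma cocycle_represents ys z : cocycle ys z ->
  exists n m, represents ys n m z.
Proof.
elim: ys z => [|y ys IH] z /=.
  move=> [_ dz]; have /seteqP[/(_ _ dz)[m _ <-] _] := res_exact0 I.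
  by exists 0%N, m.
move=> [/torsion_cons[yz [n ynz]] dz].
have [w yw dw] : cobound ys (size ys).+1 z by apply: lc_vanish_gt_size.
have /IH[n' [m mE]] : cocycle ys (y ^+ n *: w).
  split; first exact: submodZ (@is_submodule_torsion _ _ _) yw.
  by rewrite linearZ_LR dw.
(* The cochain w stands for m / (y^n P^n'), P the product of [ys]; the witness brings this to the
   common exponent n' + n. *)
exists (n' + n)%N, (y ^+ n' *: ((\prod_(x <- ys) x) ^+ n *: m)).
exists (y ^+ n' *: (y ^+ n *: w)), w, 0%N; split=> //.
  exact/representsZ/represents_raise.
by rewrite addn0 scale1r scalerA exprD.
Qed.

(** By exactness, the image of z' / y^n under the connecting map is zero iff z' / y^n comes from a
    class of H_ys, itself some m' / P^n'. The induction hypothesis turns this equality in the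
    localisation into a membership in M. *)
Lemma represents_cobound ys n m z : represents ys n m z ->
  cobound ys (size ys) z <->
  exists k, pow_combo [set 0] ys (n + k) ((\prod_(y <- ys) y) ^+ k *: m).
Proof.
elim: ys n m z => [|y ys IH] n m z /=.
  move=> ->; rewrite big_nil; split=> [/eqP|[k]] /=.
    rewrite -[0](linear0 (res_aug I)) => /eqP /(@res_aug_inj _ _ I) ->.
    by exists 0%N; rewrite scaler0.
  by rewrite expr1n scale1r => ->; rewrite linear0.
have Csub := @is_submodule_cobound ys (size ys).
have Tsub := @is_submodule_torsion _ (I (size ys)) ys.
set P := \prod_(x <- ys) x in IH *; rewrite big_cons -/P.
move=> [z' [w [k [z'E yw wE ->]]]]; split=> [[u /torsion_cons[yu [l ylu]] du]|].
  (* The cocycle w - u is the lift of z' / y^n to H_ys. *)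
  have wu_coc : cocycle ys (w - u).
    by split; [exact: submodB Tsub yw yu|rewrite linearB du subrr].
  have [n' [m' m'E]] := cocycle_represents wu_coc.
  pose L := (l + (n + k))%N.
  have ywu : y ^+ (l + k) *: z' - y ^+ L *: (w - u) = 0.
    rewrite scalerBr exprD -scalerA -wE scalerA -exprD.
    rewrite [y ^+ L *: u](expr_scale0_le _ ylu) ?leq_addr //.
    by rewrite subr0 subrr.
  have /IH[/(_ _)[|p]] : represents ys (n + n')
      (y ^+ (l + k) *: (P ^+ n' *: m) + - y ^+ L *: (P ^+ n *: m')) 0.
    rewrite -ywu -scaleNr; apply: representsD; apply: representsZ.
      exact: represents_raise.
    by rewrite addnC; apply: represents_raise.
    exact: submod0.
  move=> /(pow_combo_raise (l + k) (is_submodule0 M)) Hp _.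
  exists (n' + p + (l + k))%N.
  exists (P ^+ (n + p + (l + k)) *: m').
  have -> : (n + (n' + p + (l + k)) = n + n' + p + (l + k))%N by rewrite !addnA.
  suff -> : (y * P) ^+ (n' + p + (l + k)) *: m - y ^+ (n + n' + p + (l + k)) *:
        (P ^+ (n + p + (l + k)) *: m') =
      y ^+ (n' + p) *: (P ^+ (l + k) *: (P ^+ p *:
        (y ^+ (l + k) *: (P ^+ n' *: m) + - y ^+ L *: (P ^+ n *: m')))).
    exact: submodZ (is_submodule_pow_combo _ _ (is_submodule0 M)) Hp.
  rewrite scaleNr !scalerBr !scalerA; congr (_ *: _ - _ *: _).
    by rewrite exprMn !exprD; ring.
  by rewrite /L !exprD; ring.
move=> [p [m'' m''E]].
(* Now z'' is the lift: w - z'' is y-torsion up to a coboundary w', and d (w - z'' - w') = d w. *)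
have [z'' z''E] := represents_exists ys (n + p) m''.
have : cobound ys (size ys) (y ^+ p *: z' + - y ^+ (n + p) *: z'').
  apply/(IH (n + p)%N (y ^+ p *: (P ^+ p *: m) + - y ^+ (n + p) *: m'')).
    apply: representsD; apply: representsZ => //.
    exact: represents_raise.
  exists 0%N; rewrite addn0 scale1r scaleNr scalerA -exprMn.
  exact: m''E.
move=> /(submodZ (y ^+ k) Csub).
have -> : y ^+ k *: (y ^+ p *: z' + - y ^+ (n + p) *: z'') =
    y ^+ (n + k + p) *: (w - z'').
  rewrite scaleNr !scalerBr !scalerA -exprD; congr (_ - _ *: _).
    by rewrite [in RHS]exprD mulrC -[RHS]scalerA wE scalerA -exprD addnC.
  by rewrite !exprD; ring.
move=> /cobound_divide[w' /sub_cobound_cocycle[yw' dw'] [q yq]].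
have [yz'' dz''] := represents_cocycle z''E.
exists (w - z'' - w'); last by rewrite !linearB dz'' dw' !subr0.
apply/torsion_cons; split; last by exists q.
exact: submodB Tsub (submodB Tsub yw yz'') yw'.
Qed.

Theorem lc_vanish_size ys : lc_vanish ys (size ys) <->
  forall n (m : M), exists k,
    pow_combo [set 0] ys (n + k) ((\prod_(y <- ys) y) ^+ k *: m).
Proof.
split=> [van n m|H z z_coc].
  have [z zE] := represents_exists ys n m.
  by apply/(represents_cobound zE)/van/represents_cocycle/zE.
have [n [m zE]] := cocycle_represents z_coc.
exact: (represents_cobound zE).2 (H n m).
Qed.

End Cohomology.

(** * Injective resolutions *)

Section DivisibleExtension.
Variables (V D : zmodType).
Hypothesis D_div : forall n (d : D), (0 < n)%N -> exists e, e *+ n = d.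

Definition subgroup (T : zmodType) (A : set T) : Prop :=
  A 0 /\ forall p q, A p -> A q -> A (p - q).

Lemma subgroupD (T : zmodType) (A : set T) p q :
  subgroup A -> A p -> A q -> A (p + q).
Proof.
move=> [A0 AB] Ap Aq; rewrite -[q]opprK; apply: (AB) => //.
by rewrite -sub0r; apply: (AB).
Qed.

Lemma subgroupMz (T : zmodType) (A : set T) p k :
  subgroup A -> A p -> A (p *~ k).
Proof.
move=> A_sub Ap; have ApM n : A (p *+ n).
  elim: n => [|n IH]; first by rewrite mulr0n; case: A_sub.
  by rewrite mulrS; apply: subgroupD.
case: k => n; first exact: ApM.
rewrite NegzE mulrNz -sub0r; have [A0 AB] := A_sub.
by apply: (AB) => //; apply: ApM.
Qed.

(** A is the graph of an additive map on a subgroup. If a positive multiple of v lies in the domain,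
    the least such n divides all others by Euclidean division, so e is the value at n v divided by
    n; otherwise e = 0 works. *)
Lemma extension_value (A : set (V * D)%type) v : subgroup A ->
  (forall d, A (0, d) -> d = 0) ->
  exists e, forall k d, A (v *~ k, d) -> d = e *~ k.
Proof.
move=> A_sub A_fun; have [A0 AB] := A_sub.
have [[n0 n0P]|no_mult] :=
  pselect (exists n, `[< (0 < n)%N /\ exists d, A (v *+ n, d) >]); last first.
  exists 0 => k d Akd; rewrite mul0rz; apply: A_fun.
  case: k Akd => [[//|n] Akd|n Akd]; case: no_mult; exists n.+1; apply/asboolP.
    by split=> //; exists d.
  split=> //; exists (- d).
  have -> : v *+ n.+1 = - (v *~ Negz n) by rewrite NegzE mulrNz opprK.
  by rewrite -[(_, _)]/(- (v *~ Negz n, d)) -sub0r; apply: (AB).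
have n_ex : exists n, `[< (0 < n)%N /\ exists d, A (v *+ n, d) >] by exists n0.
case: (ex_minnP n_ex) => n /asboolP[n_gt0 [d0 Ad0]] n_min.
have [e eE] := D_div d0 n_gt0.
exists e => k d Akd; pose q := (k %/ n)%Z; pose r := `|(k %% n)%Z|%N.
have kE : k = q * n + r.
  by rewrite /r gez0_abs ?modz_ge0 ?eqz_nat -?lt0n //; apply: divz_eq.
have Ar : A (v *+ r, d - d0 *~ q).
  have -> : (v *+ r, d - d0 *~ q) = (v *~ k, d) - (v *+ n, d0) *~ q.
    rewrite [X in _ = _ - X]surjective_pairing (raddfMz fst) (raddfMz snd) /=.
    rewrite -[RHS]/(_ - _, _ - _).
    by rewrite !pmulrn -mulrzA -mulrzBr kE [n%:Z * q]mulrC addrAC subrr add0r.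
  by apply: (AB) => //; apply: subgroupMz.
have r0 : r = 0%N.
  apply/eqP; rewrite -leqn0 leqNgt; apply/negP => r_gt0.
  have : (n <= r)%N.
    by apply: n_min; apply/asboolP; split=> //; exists (d - d0 *~ q).
  rewrite leqNgt -ltz_nat /r gez0_abs ?modz_ge0 ?eqz_nat -?lt0n //.
  by rewrite ltz_pmod.
move: Ar; rewrite r0 => /A_fun /eqP; rewrite subr_eq0 => /eqP ->.
by rewrite kE r0 addr0 mulrC mulrzA -eE.
Qed.

Lemma additive_extension (A0 : set (V * D)%type) : subgroup A0 ->
  (forall d, A0 (0, d) -> d = 0) ->
  exists f : {additive V -> D}, forall v d, A0 (v, d) -> f v = d.
Proof.
move=> A0_sub A0_fun.
(* The last clause demands A0 inside A only for inhabited A, so that the union of the empty chain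
   satisfies P. *)
pose P (A : set (V * D)%type) := [/\ forall p q, A p -> A q -> A (p - q),
  forall d, A (0, d) -> d = 0 & forall p, A p -> A0 `<=` A].
have [F FP F_tot|A [[AB A_fun A_A0] A_max]] := @Zorn_bigcup _ P.
  split=> [p q [X FX Xp] [Y FY Yq]|d [X FX Xd]|p [X FX Xp] q A0q].
  - have [XY|YX] := F_tot _ _ FX FY.
      by exists Y => //; have [YB _ _] := FP _ FY; apply: (YB) => //; apply: XY.
    by exists X => //; have [XB _ _] := FP _ FX; apply: (XB) => //; apply: YX.
  - by have [_ X_fun _] := FP _ FX; apply: X_fun.
  - by exists X => //; have [_ _ X_A0] := FP _ FX; apply: (X_A0 p).
have A0A : A0 `<=` A.
  have [[p /A_A0 //]|A_empty] := pselect (exists p, A p).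
  exfalso; apply: (A_max A0); last first.
    by split; [case: A0_sub|exact: A0_fun|move=> p _].
  split=> [p Ap|sub]; first by case: A_empty; exists p.
  by apply: A_empty; exists 0; apply: sub; case: A0_sub.
have A_sub : subgroup A by split=> //; apply: A0A; case: A0_sub.
have A_tot v : exists d, A (v, d).
  have [e eE] := extension_value v A_sub A_fun.
  pose B := [set p + (v *~ k, e *~ k) | p in A & k in [set: int]].
  have AsubB : A `<=` B.
    by move=> p Ap; exists p => //; exists 0 => //; rewrite !mulr0z addr0.
  suff PB : P B.
    exists e; have [//|nA] := pselect (A (v, e)); exfalso.
    apply: (A_max B) => //.
    split=> // BA; apply/nA/BA; exists 0; first by case: A_sub.
    by exists 1 => //; rewrite !mulr1z add0r.
  split=> [_ _ [p Ap [k _ <-]] [q Aq [l _ <-]]|d [[u c] Auc [k _ []]]|p _].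
  - exists (p - q); first exact: AB.
    exists (k - l) => //; rewrite opprD addrACA; congr (_ + _).
    by rewrite !mulrzBr.
  - move=> /eqP; rewrite addr_eq0 => /eqP uE <-.
    have /eE/eqP : A (v *~ k, - c).
      have -> : (v *~ k, - c) = 0 - (u, c).
        by rewrite sub0r uE -[RHS]/(- - _, _) opprK.
      by apply: (AB) => //; case: A_sub.
    by rewrite eqr_oppLR => /eqP ->; rewrite addNr.
  - by move=> q /A0A /AsubB.
have [f Af] := choice A_tot.
have f_uniq v d : A (v, d) -> f v = d.
  move=> Ad; apply/eqP; rewrite -subr_eq0; apply/eqP/A_fun.
  by rewrite -[0](subrr v) -[(_, _)]/((v, f v) - (v, d)); apply: (AB).
have f_add : zmod_morphism f.
  move=> u v; apply: f_uniq.
  by rewrite -[(_, _)]/((u, f u) - (v, f v)); apply: (AB).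
pose fA : {additive V -> D} :=
  HB.pack f (GRing.isZmodMorphism.Build V D f f_add).
by exists fA => v d /A0A; apply: f_uniq.
Qed.

End DivisibleExtension.

(** * Q/Z and its characters *)

Section QmodZ.

Definition int_in_rat : set (zmodule rat) := [set q : rat | q \is a Num.int].

Fact is_submodule_int_in_rat : @is_submodule int (zmodule rat) int_in_rat.
Proof.
split=> [|u v|r v]; rewrite /int_in_rat /=; first exact: rpred0.
  exact: rpredD.
by rewrite scalezrE; apply: rpredMz.
Qed.

Definition ratz : zmodType := quot_mod int_in_rat.

Definition to_ratz (q : rat) : ratz := @qpi int (zmodule rat) int_in_rat q.

Fact to_ratz_zmod_morphism : zmod_morphism to_ratz.
Proof. exact: (@linearB _ _ _ _ (@qpi int (zmodule rat) int_in_rat)). Qed.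

HB.instance Definition _ :=
  GRing.isZmodMorphism.Build rat ratz to_ratz to_ratz_zmod_morphism.

Lemma to_ratz_eq0 q : to_ratz q = 0 <-> q \is a Num.int.
Proof. exact: (qpi_ker is_submodule_int_in_rat). Qed.

Lemma ratz_divisible n (d : ratz) : (0 < n)%N -> exists e, e *+ n = d.
Proof.
move=> n_gt0; have [q <-] := qpi_surj d.
exists (to_ratz ((q : rat) / n%:R)).
rewrite -raddfMn -[_ *+ n]mulr_natr divfK //.
by rewrite pnatr_eq0 -lt0n.
Qed.

Lemma to_ratz_invn_neq0 n : (1 < n)%N -> to_ratz n%:R^-1 <> 0.
Proof.
move=> n_gt1 /to_ratz_eq0 /intrP[m mE].
have : (n%:Z * m = 1)%R.
  apply: (@intr_inj rat); rewrite intrM -mE -pmulrn mulfV //.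
  by rewrite pnatr_eq0 -lt0n ltnW.
move=> nm1; have : (n%:Z %| 1)%Z by apply/dvdzP; exists m; rewrite mulrC.
by rewrite dvdzE dvdn1 => /eqP n1; rewrite -[n]/(`|n%:Z|%N) n1 in n_gt1.
Qed.

(** If v has finite order n, take the class of 1/n; if it has infinite order, any nonzero class
    does, here that of 1/2. *)
Lemma ratz_character_value (V : zmodType) (v : V) : v <> 0 ->
  exists2 e : ratz, e <> 0 & forall k, v *~ k = 0 -> e *~ k = 0.
Proof.
move=> v0; have [n_ex|no_n] := pselect (exists n, (0 < n)%N && (v *+ n == 0)).
  case: (ex_minnP n_ex) => n /andP[n_gt0 /eqP vn] n_min.
  have n_gt1 : (1 < n)%N.
    by case: n n_gt0 vn {n_min} => [|[|n]] // _ /v0.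
  exists (to_ratz n%:R^-1); first exact: to_ratz_invn_neq0.
  move=> k vk; rewrite (divz_eq k n) mulrzDr mulrzA.
  have n0 : n%:Z != 0 by rewrite eqz_nat -lt0n.
  have -> : (k %% n)%Z = 0.
    have : v *~ (k %% n)%Z = 0.
      by rewrite /modz mulrzBr vk mulrC mulrzA -pmulrn vn mul0rz subr0.
    have := modz_ge0 k n0; case E : (k %% n)%Z => [r|//] _ vr.
    case: r E vr => // r E vr; have := ltz_pmod k (n_gt0 : (0 < n%:Z)%R).
    rewrite E ltz_nat ltnNge n_min //=.
    exact/eqP.
  rewrite mulr0z addr0 -mulrzA mulrC mulrzA -pmulrn -raddfMn.
  rewrite -[_^-1 *+ n]mulr_natr.
  rewrite mulVf; last by rewrite pnatr_eq0 -lt0n.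
  by rewrite /= (to_ratz_eq0 1).2 ?mul0rz ?rpred1.
exists (to_ratz 2%:R^-1); first exact: to_ratz_invn_neq0.
have no_pos n : v *+ n.+1 <> 0.
  by move=> vn; apply: no_n; exists n.+1; apply/eqP.
case=> [[|n]|n] // vn; first by case: (no_pos n).
by move/eqP: vn; rewrite NegzE mulrNz oppr_eq0 => /eqP/no_pos.
Qed.

Lemma ratz_characters (V : zmodType) (v : V) : v <> 0 ->
  exists f : {additive V -> ratz}, f v <> 0.
Proof.
move=> /ratz_character_value[e e0 eE].
have [||f fE] := @additive_extension V ratz ratz_divisible
    [set p | exists k, p = (v *~ k, e *~ k)].
- split=> [|_ _ [k ->] [l ->]]; first by exists 0; rewrite !mulr0z.
  by exists (k - l); rewrite !mulrzBr.
- by move=> d [k [/esym/eE ek ->]].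
by exists f; rewrite (fE v e) //; exists 1; rewrite !mulr1z.
Qed.

End QmodZ.

(* Coinduced modules Hom_Z(R, Q/Z)^X, with R acting through the argument. *)
Section Coinduced.
Variables (R : comPzRingType) (X : Type).

Record coind := Coind {
  coind_val :> X -> R -> ratz;
  coind_valB : forall x r s,
    coind_val x (r - s) = coind_val x r - coind_val x s }.

Lemma coindP (f g : coind) : (forall x r, f x r = g x r) -> f = g.
Proof.
case: f g => [f fB] [g gB] /= fg.
have E : f = g by apply: funext => x; apply: funext => r.
by case: _ / E gB => gB; congr Coind; apply: Prop_irrelevance.
Qed.

HB.instance Definition _ := gen_eqMixin coind.
HB.instance Definition _ := gen_choiceMixin coind.

Lemma coind_valD (f : coind) x r s : f x (r + s) = f x r + f x s.
Proof.
have f0 : f x 0 = 0 by rewrite -(subrr (0 : R)) coind_valB subrr.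
by rewrite -{1}[s]opprK coind_valB -(sub0r s) coind_valB f0 sub0r opprK.
Qed.

Definition coind_zero := @Coind (fun _ _ => 0) (fun _ _ _ => esym (subrr 0)).

Fact coind_opp_subproof (f : coind) x r s :
  - f x (r - s) = - f x r - - f x s.
Proof. by rewrite coind_valB opprD. Qed.
Definition coind_opp (f : coind) := Coind (coind_opp_subproof f).

Fact coind_add_subproof (f g : coind) x r s :
  f x (r - s) + g x (r - s) = f x r + g x r - (f x s + g x s).
Proof. by rewrite !coind_valB opprD addrACA. Qed.
Definition coind_add (f g : coind) := Coind (coind_add_subproof f g).

Fact coind_scale_subproof a (f : coind) x r s :
  f x ((r - s) * a) = f x (r * a) - f x (s * a).
Proof. by rewrite mulrBl coind_valB. Qed.
Definition coind_scale (a : R) (f : coind) :=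
  @Coind (fun x r => f x (r * a)) (coind_scale_subproof a f).

Fact coind_addA : associative coind_add.
Proof. by move=> f g h; apply: coindP => x r /=; rewrite addrA. Qed.
Fact coind_addC : commutative coind_add.
Proof. by move=> f g; apply: coindP => x r /=; rewrite addrC. Qed.
Fact coind_add0 : left_id coind_zero coind_add.
Proof. by move=> f; apply: coindP => x r /=; rewrite add0r. Qed.
Fact coind_addN : left_inverse coind_zero coind_opp coind_add.
Proof. by move=> f; apply: coindP => x r /=; rewrite addNr. Qed.

HB.instance Definition _ := GRing.isZmodule.Build coind
  coind_addA coind_addC coind_add0 coind_addN.

Fact coind_scaleA a b f :
  coind_scale a (coind_scale b f) = coind_scale (a * b) f.
Proof. by apply: coindP => x r /=; rewrite mulrA. Qed.
Fact coind_scale1 : left_id 1 coind_scale.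
Proof. by move=> f; apply: coindP => x r /=; rewrite mulr1. Qed.
Fact coind_scaleDr : right_distributive coind_scale +%R.
Proof. by move=> a f g; apply: coindP. Qed.
Fact coind_scaleDl f : {morph coind_scale^~ f : a b / a + b}.
Proof.
move=> a b; apply: coindP => x r /=.
by rewrite mulrDr coind_valD.
Qed.

HB.instance Definition _ := GRing.Zmodule_isLmodule.Build R coind
  coind_scaleA coind_scale1 coind_scaleDr coind_scaleDl.

(** Evaluation at 1 identifies linear maps into [coind] with families of additive maps into Q/Z, and
    these extend by divisibility. *)
Lemma coind_injective : injective_module coind.
Proof.
move=> U V f g f_inj.
have ext x : exists c : {additive V -> ratz}, forall u, c (f u) = g u x 1.
  pose G := [set p : V * ratz | exists u, p = (f u, g u x 1)].
  have [||c cE] := @additive_extension V ratz ratz_divisible G.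
  - split=> [|_ _ [u ->] [v ->]]; first by exists 0; rewrite !linear0.
    by exists (u - v); rewrite !linearB.
  - move=> d [u [/esym fu0 ->]].
    by rewrite (f_inj u 0) ?linear0.
  by exists c => u; apply: cE; exists u.
have [c cE] := choice ext.
pose h v := @Coind (fun x r => c x (r *: v))
  (fun x r s => eq_trans (congr1 (c x) (scalerBl r s v)) (raddfB (c x) _ _)).
have h_lin : linear h.
  move=> a u v; apply: coindP => x r /=.
  by rewrite scalerDr raddfD scalerA.
pose hL : {linear V -> coind} :=
  HB.pack h (GRing.isLinear.Build R V coind _ h h_lin).
exists hL => u; apply: coindP => x r /=.
by rewrite -linearZ_LR cE linearZ_LR /= mul1r.
Qed.

End Coinduced.

Section Resolution.
Variable R : comPzRingType.
Implicit Type M : lmodType R.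

(** One factor for each character of M, so that together they separate points. *)
Definition hull M : lmodType R := coind R {additive M -> ratz}.

Definition hull_map M (m : M) : hull M :=
  @Coind R _ (fun (x : {additive M -> ratz}) r => x (r *: m))
  (fun x r s => eq_trans (congr1 x (scalerBl r s m)) (raddfB x _ _)).

Fact hull_map_linear M : linear (@hull_map M).
Proof.
by move=> a u v; apply: coindP => x r /=; rewrite scalerDr raddfD scalerA.
Qed.

HB.instance Definition _ M :=
  GRing.isLinear.Build R M (hull M) _ (@hull_map M) (@hull_map_linear M).

Lemma hull_map_inj M : injective (@hull_map M).
Proof.
move=> u v uv; apply: contrapT => uv0.
have /ratz_characters[x xuv] : u - v <> 0.
  by move=> /eqP; rewrite subr_eq0 => /eqP.
apply: xuv; rewrite raddfB.
have : hull_map u x 1 = hull_map v x 1 by rewrite uv.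
by rewrite /= !scale1r => ->; rewrite subrr.
Qed.

Fixpoint cosyzygy M i : lmodType R :=
  if i is j.+1 then quot_mod (range (@hull_map (cosyzygy M j))) else M.

Definition cosyzygy_diff M i : {linear hull (cosyzygy M i) ->
    hull (cosyzygy M i.+1)} :=
  @hull_map (cosyzygy M i.+1) \o qpi (range (@hull_map (cosyzygy M i))).

Lemma cosyzygy_diff_eq0 M i z :
  cosyzygy_diff M i z = 0 <-> range (@hull_map (cosyzygy M i)) z.
Proof.
have sub := is_submodule_range (@hull_map (cosyzygy M i)).
split=> [/=|/(qpi_ker sub) /= -> ]; last by rewrite linear0.
rewrite -[RHS](linear0 (@hull_map (cosyzygy M i.+1))) => /hull_map_inj.
by move=> /(qpi_ker sub).
Qed.

Lemma injective_resolution_exists M : inhabited (injective_resolution M).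
Proof.
constructor; refine (@InjRes R M (fun i => hull (cosyzygy M i))
  (@hull_map M) (cosyzygy_diff M) _ _ _ _).
- by move=> i; apply: coind_injective.
- exact: hull_map_inj.
- by apply/seteqP; split=> z; case: (cosyzygy_diff_eq0 (M := M) (i := 0) z).
- move=> i; apply/seteqP; split=> [z|_ [w _ <-]].
    case: (cosyzygy_diff_eq0 z) => + _ => /[apply] -[c _ <-].
    by have [w <-] := qpi_surj c; exists w.
  by apply/cosyzygy_diff_eq0; exists (qpi _ w).
Qed.

End Resolution.

(** * Systems of parameters *)

Section PowerMembership.
Variables (R : comPzRingType).
Implicit Types (V : lmodType R) (xs ys : seq R) (x : R).

(* For W = 0 this says that H^(size ys)_<ys>(V) = 0, see [lc_vanish_size]. *)
Definition power_saturated V (W : set V) ys : Prop :=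
  forall n v, exists k, pow_combo W ys (n + k) ((\prod_(y <- ys) y) ^+ k *: v).

Lemma power_saturated_cons V (W : set V) x ys : is_submodule W ->
  power_saturated (combo [:: x] W) ys -> power_saturated W (x :: ys).
Proof.
move=> Ws sat; set P := \prod_(y <- ys) y in sat *.
have sat_pow p n v : exists k u,
    pow_combo W ys (n + k) (P ^+ k *: v - x ^+ p *: u).
  elim: p => [|p [k [u Hu]]].
    exists 0%N, v; rewrite !scale1r subrr.
    exact: submod0 (is_submodule_pow_combo _ _ Ws).
  have [l] := sat (n + k)%N u; rewrite /pow_combo comboC // => -[w Hw].
  exists (k + l)%N, w; rewrite addnA.
  have -> : P ^+ (k + l) *: v - x ^+ p.+1 *: w =
      P ^+ l *: (P ^+ k *: v - x ^+ p *: u) + x ^+ p *: (P ^+ l *: u - x *: w).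
    rewrite !scalerBr !scalerA addrA -exprSr -exprD [(l + k)%N]addnC.
    by rewrite [x ^+ p * _]mulrC subrK.
  apply: submodD (is_submodule_pow_combo _ _ Ws) _ _.
    exact: pow_combo_raise.
  exact: submodZ (is_submodule_pow_combo _ _ Ws) Hw.
move=> n v; have [k [u Hu]] := sat_pow n n v.
exists k; exists u; rewrite big_cons -/P.
have -> : (x * P) ^+ k *: v - x ^+ (n + k) *: u =
    x ^+ k *: (P ^+ k *: v - x ^+ n *: u).
  by rewrite scalerBr !scalerA exprMn -exprD addnC.
exact: submodZ (is_submodule_pow_combo _ _ Ws) Hu.
Qed.

Lemma power_saturated_cat V (W : set V) xs ys : is_submodule W ->
  power_saturated (combo xs W) ys -> power_saturated W (xs ++ ys).
Proof.
elim: xs W => //= x xs IH W Ws sat; apply: power_saturated_cons => //.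
apply: IH; first exact: (is_submodule_combo [:: x]).
by rewrite (comboC xs [:: x]).
Qed.

Lemma power_saturated_quotient V (W : set V) ys : is_submodule W ->
  power_saturated [set 0 : quot_mod W] ys -> power_saturated W ys.
Proof.
move=> Ws sat n v; have [k Hk] := sat n (qpi W v); exists k; move: Hk.
rewrite -linearZ /pow_combo -[X in X -> _]/((qpi W @^-1` combo _ _) _).
rewrite combo_preimage; last exact: qpi_surj.
suff -> : qpi W @^-1` [set 0] = W by [].
by apply/seteqP; split=> u /qpi_ker; apply.
Qed.

End PowerMembership.

(** * The determinant trick *)

Section DeterminantTrick.
Variable R : comPzRingType.

Lemma det_congr (J : set R) n (B C : 'M[R]_n) : is_ideal J ->
  (forall i j, J (B i j - C i j)) -> J (\det B - \det C).
Proof.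
move=> J_ideal BC; rewrite /determinant -sumrB.
elim/big_rec: _ => [|s r _ Jr]; first exact: ideal0.
apply: idealD => //; rewrite -mulrBr; apply: idealMl => //.
elim/big_rec2: _ => [|i b c _ Jbc]; first by rewrite subrr; apply: ideal0.
have -> : B i (s i) * c - C i (s i) * b =
    (B i (s i) - C i (s i)) * c + C i (s i) * (c - b) by ring.
by apply: idealD => //; [apply: idealMr|apply: idealMl].
Qed.

Definition gen_combos (M : lmodType R) n (e : 'I_n -> M) (J : set R) : set M :=
  [set v | exists2 a : 'I_n -> R, forall i, J (a i) & v = \sum_i a i *: e i].

Lemma is_submodule_gen_combos (M : lmodType R) n (e : 'I_n -> M) (J : set R) :
  is_ideal J -> is_submodule (gen_combos e J).
Proof.
move=> J_ideal; split=> [|_ _ [a Ja ->] [b Jb ->]|r _ [a Ja ->]].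
- exists (fun=> 0) => [_|]; first exact: ideal0.
  by rewrite big1 // => i _; rewrite scale0r.
- exists (fun i => a i + b i) => [i|]; first exact: idealD.
  by rewrite -big_split; apply: eq_bigr => i _; rewrite scalerDl.
- exists (fun i => r * a i) => [i|]; first exact: idealMl.
  by rewrite scaler_sumr; apply: eq_bigr => i _; rewrite scalerA.
Qed.

(** On generators e, s e = A e with A over <xs>. By the adjugate, det (s - A) kills M, and it is
    congruent to s^n modulo <xs>. *)
Lemma determinant_trick (M : lmodType R) xs (s : R) : fin_gen M ->
  (forall m : M, combo xs [set 0] (s *: m)) ->
  exists n t, gen_ideal xs t /\ ann M (s ^+ n - t).
Proof.
move=> [ms msM] sM; pose e (i : 'I_(size ms)) := ms`_i.
have setT_ideal : is_ideal [set: R] by [].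
have J_ideal := gen_ideal_ideal xs.
have eM m : gen_combos e [set: R] m.
  suff : submodule_span [set` ms] `<=` gen_combos e [set: R].
    by apply; rewrite msM.
  apply: span_min; first exact: is_submodule_gen_combos.
  move=> u /= /(nthP 0)[k k_lt <-]; pose i := Ordinal k_lt.
  exists (fun j => (j == i)%:R) => //.
  rewrite (bigD1 i) //= eqxx scale1r big1 ?addr0 // => j /negPf ->.
  by rewrite scale0r.
have eJ m : gen_combos e (gen_ideal xs) (s *: m).
  apply: combo_min (sM m); first exact: is_submodule_gen_combos.
    by move=> _ ->; apply: submod0 (is_submodule_gen_combos _ J_ideal).
  move=> x v xxs; have [a _ ->] := eM v.
  exists (fun i => x * a i) => [i|]; last first.
    by rewrite scaler_sumr; apply: eq_bigr => i _; rewrite scalerA.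
  exact: idealMr J_ideal (mem_gen_ideal xxs).
have {eJ} [A AE] := choice (fun i =>
  let: ex_intro2 a Ja aE := eJ (e i) in ex_intro _ a (conj Ja aE)).
pose B : 'M[R]_(size ms) := s%:M - \matrix_(i, j) A i j.
have Be i : \sum_j B i j *: e j = 0.
  have -> : \sum_j B i j *: e j = (\sum_j s *+ (i == j) *: e j) - s *: e i.
    rewrite (AE i).2 -sumrB; apply: eq_bigr => j _.
    by rewrite !mxE scalerBl.
  rewrite (bigD1 i) //= eqxx big1 ?addr0 ?subrr // => j.
  rewrite eq_sym => /negPf ->.
  by rewrite scale0r.
have detBe k : \det B *: e k = 0.
  have : \sum_i \adj B k i *: (\sum_j B i j *: e j) = 0.
    by rewrite big1 // => i _; rewrite Be scaler0.
  under eq_bigr => i _ do rewrite scaler_sumr.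
  rewrite exchange_big /= => <-; rewrite (bigD1 k) //= [X in _ = _ + X]big1.
    rewrite addr0; have /matrixP/(_ k k) := mul_adj_mx B.
    rewrite [LHS]mxE [RHS]mxE eqxx mulr1n => <-.
    by rewrite scaler_suml; apply: eq_bigr => i _; rewrite scalerA.
  move=> j /negPf jk; under eq_bigr => i _ do rewrite scalerA.
  rewrite -scaler_suml; have /matrixP/(_ k j) := mul_adj_mx B.
  by rewrite [LHS]mxE [RHS]mxE eq_sym jk => ->; rewrite scale0r.
exists (size ms), (s ^+ size ms - \det B); split.
  rewrite -det_scalar; apply: det_congr => // i j.
  rewrite !mxE opprB addrCA subrr addr0; exact: (AE i).1.
move=> m; rewrite opprB addrCA subrr addr0.
by have [a _ ->] := eM m; rewrite scaler_sumr big1 // => i _;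
  rewrite scalerA mulrC -scalerA detBe scaler0.
Qed.

End DeterminantTrick.

Section Extrema.

(** A finite supremum is attained, since otherwise n - 1 would be an upper bound. *)
Lemma supremum_natP (S : set nat) n :
  supremum -oo%E [set (i%:Z)%:E | i in S] = (n%:Z)%:E :> \bar int <->
  S n /\ forall i, S i -> (i <= n)%N.
Proof.
split=> [|[Sn n_max]]; last first.
  rewrite /supremum; case: eqP => [S0|_].
    by have : [set (i%:Z)%:E | i in S] (n%:Z)%:E; [exists n|rewrite S0].
  have n_sup : supremums [set (i%:Z)%:E | i in S] (n%:Z)%:E.
    split=> [_ [i Si <-]|y]; first by rewrite lee_fin lez_nat n_max.
    by apply; exists n.
  exact: (is_subset1_supremums (xgetPex _ (ex_intro _ _ n_sup)) n_sup).
rewrite /supremum; case: ifP => // _.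
case: xgetP => [y _ [y_ub y_least] yE|_ //]; rewrite {}yE in y_ub y_least.
have n_max i : S i -> (i <= n)%N.
  by move=> Si; rewrite -lez_nat -lee_fin; apply: y_ub; exists i.
split=> //; apply: contrapT => nSn.
have : ((n%:Z)%:E <= ((n%:Z - 1)%R)%:E :> \bar int)%E.
  apply: y_least => _ [i Si <-]; rewrite lee_fin lerBrDr lezD1 ltz_nat.
  by rewrite ltn_neqAle n_max // andbT; apply/eqP => in_; rewrite in_ in Si.
by rewrite lee_fin lerBrDr gerDl.
Qed.

Lemma infimum_nat (S : set nat) n : S n -> (forall i, S i -> (n <= i)%N) ->
  infimum +oo%E [set (i%:Z)%:E | i in S] = (n%:Z)%:E :> \bar int.
Proof.
move=> Sn n_min; rewrite /infimum; case: eqP => [S0|_].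
  by have : [set (i%:Z)%:E | i in S] (n%:Z)%:E; [exists n|rewrite S0].
have n_inf : infimums [set (i%:Z)%:E | i in S] ((n%:Z)%:E : \bar int).
  split=> [_ [i Si <-]|y]; first by rewrite lee_fin lez_nat n_min.
  by apply; exists n.
exact: (is_subset1_infimums (xgetPex _ (ex_intro _ _ n_inf)) n_inf).
Qed.

End Extrema.

(** * Nonvanishing in the top degree *)

Section TopCohomology.
Variables (R : comPzRingType) (M : lmodType R).
Hypothesis R_noeth : noetherian R.
Implicit Types (xs ys : seq R).

Lemma lc_nonzero_le_size xs ys i :
  same_radical M (gen_ideal ys) (gen_ideal xs) ->
  lc_nonzero (gen_ideal xs) M i -> (i <= size ys)%N.
Proof.
move=> rad_eq [I nvan]; rewrite leqNgt; apply/negP => i_gt; apply: nvan.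
apply/(lc_vanishE I)/(same_radical_lc_vanish I R_noeth i rad_eq).
exact: lc_vanish_gt_size.
Qed.

Lemma lc_nonzero_size xs ys :
  same_radical M (gen_ideal ys) (gen_ideal xs) ->
  lc_nonzero (gen_ideal xs) M (size ys) <-> ~ power_saturated [set 0 : M] ys.
Proof.
move=> rad_eq; split=> [[I nvan] sat|nsat].
  apply/nvan/(lc_vanishE I)/(same_radical_lc_vanish I R_noeth _ rad_eq).
  exact/lc_vanish_size.
have [I] := injective_resolution_exists M; exists I => van; apply: nsat.
apply/(lc_vanish_size I R_noeth)/(same_radical_lc_vanish I R_noeth _ rad_eq).
exact/lc_vanishE.
Qed.

End TopCohomology.

Section SystemsOfParameters.
Variables (R : comPzRingType) (a : set R).
Hypotheses (R_noeth : noetherian R) (a_ideal : is_ideal a).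
Implicit Types (M : lmodType R) (xs ys zs : seq R).

Local Notation proj M xs := (qpi (smul (gen_ideal xs) [set: M])).

Lemma proj_surj M xs (q : quot_seq M xs) : exists v, proj M xs v = q.
Proof. exact: qpi_surj. Qed.

Lemma proj_eq0 M xs v : proj M xs v = 0 <-> combo xs [set 0] v.
Proof.
rewrite -smul_gen_idealE; apply: qpi_ker; exact: is_submodule_span.
Qed.

Lemma combo_proj M xs ys v :
  combo ys [set 0] (proj M xs v) <-> combo (xs ++ ys) [set 0] v.
Proof.
rewrite -[X in X <-> _]/((proj M xs @^-1` _) v) combo_preimage; last first.
  exact: qpi_surj.
have -> : proj M xs @^-1` [set 0] = combo xs [set 0].
  by apply/seteqP; split=> u /proj_eq0.
by rewrite combo_cat comboC //; apply: is_submodule0.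
Qed.

Lemma quot_seq_fin_gen M xs : fin_gen M -> fin_gen (quot_seq M xs).
Proof.
move=> [ms msM]; exists [seq proj M xs m | m <- ms].
apply/seteqP; split=> // q _; have [v <-] := proj_surj q.
have : submodule_span [set` ms] v by rewrite msM.
move: v; apply: span_min => [|m mms].
  exact: is_submodule_preimage (is_submodule_span _).
by apply: sub_span; apply: map_f.
Qed.

Lemma sop_radical M xs :
  is_sop a M xs -> a `<=` radical_mod_ann M (gen_ideal xs).
Proof. by move=> [_ _ ->]; apply: radical_mod_ann_id. Qed.

(** Since a is finitely generated, radicals may be compared on generators. *)
Lemma same_radical_sub M xs : [set` xs] `<=` a ->
  a `<=` radical_mod_ann M (gen_ideal xs) -> same_radical M (gen_ideal xs) a.
Proof.
have [as_ aE] := R_noeth a_ideal; rewrite aE => xs_a a_xs.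
apply: same_radical_gen => [x /xs_a|y yas]; first exact: radical_mod_ann_id.
by apply: a_xs; apply: mem_gen_ideal.
Qed.

Lemma sop_replace M xs zs : is_sop a M xs -> size zs = size xs ->
  [set` zs] `<=` a -> [set` xs] `<=` radical_mod_ann M (gen_ideal zs) ->
  is_sop a M zs.
Proof.
move=> xs_sop szE zs_a xs_zs; have [cdE _ _] := xs_sop; split=> //.
  by rewrite szE.
apply: same_radical_sub => // r /(sop_radical xs_sop).
by apply: radical_mod_ann_gen => //; apply: gen_ideal_ideal.
Qed.

(** If r^n = s1 + s2 modulo Ann M with s1 in the ideal of the first k entries, then s1 kills the
    quotient. *)
Lemma sop_quotient_radical M xs k : is_sop a M xs ->
  same_radical (quot_seq M (take k xs)) (gen_ideal (drop k xs)) a.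
Proof.
move=> xs_sop; apply: same_radical_sub => [x /mem_drop|r].
  by have [_ + _] := xs_sop; apply.
move=> /(sop_radical xs_sop)/radical_mod_annP[n [s [+ rsM]]].
rewrite -{1}(cat_take_drop k xs) => /gen_ideal_cat[s1 [s2 [xs_s1 xs_s2 sE]]].
apply/radical_mod_annP; exists n, s2; split=> // q; have [v <-] := proj_surj q.
rewrite -linearZ_LR; apply/proj_eq0.
have -> : r ^+ n - s2 = (r ^+ n - s) + s1 by rewrite sE; ring.
rewrite scalerDl rsM add0r; apply: gen_ideal_scale xs_s1 => [|x xxs].
  exact/is_submodule_combo/is_submodule0.
by apply: combo_gen => //; apply: is_submodule0.
Qed.

Lemma sop_quotient M xs k (N := quot_seq M (take k xs)) : is_sop a M xs ->
  cd a N = ((size (drop k xs))%:Z)%:E /\ ara a N = ((size (drop k xs))%:Z)%:E.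
Proof.
move=> xs_sop; have rad_eq := sop_quotient_radical k xs_sop.
have [cdE _ M_rad] := xs_sop; have [as_ aE] := R_noeth a_ideal.
have le_size ys i : same_radical N (gen_ideal ys) a -> lc_nonzero a N i ->
    (i <= size ys)%N.
  by rewrite aE; apply: lc_nonzero_le_size.
(* If this cohomology vanished, [power_saturated_cat] would give H^c_a(M) = 0, against cd = c. *)
have nz : lc_nonzero a N (size (drop k xs)).
  rewrite aE; rewrite aE in rad_eq; apply/lc_nonzero_size => //.
  move=> /power_saturated_quotient - /(_ (is_submodule_span _)).
  rewrite smul_gen_idealE => sat.
  have /supremum_natP[+ _] := cdE; rewrite aE; rewrite aE in M_rad.
  move=> /lc_nonzero_size -/(_ R_noeth M_rad); apply.
  rewrite -(cat_take_drop k xs); apply: power_saturated_cat => //.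
  exact: is_submodule0.
split; first by apply/supremum_natP; split=> // i; apply: le_size.
apply: infimum_nat; first by exists (drop k xs).
by move=> _ [ys [<- /le_size]]; apply.
Qed.

Lemma sop_quotient_drop M xs k : is_sop a M xs ->
  is_sop a (quot_seq M (take k xs)) (drop k xs).
Proof.
move=> xs_sop; split; first by have [] := sop_quotient k xs_sop.
  by have [_ xs_a _] := xs_sop; move=> x /mem_drop; apply: xs_a.
exact: sop_quotient_radical.
Qed.

(** If r^n - s kills the quotient, it maps M into (x_1, ..., x_k) M, and the determinant trick puts
    a power of it into (x_1, ..., x_k) + Ann M. The length is right because the cd of the quotient
    is known. *)
Lemma sop_lift M xs k zs : fin_gen M -> is_sop a M xs ->
  is_sop a (quot_seq M (take k xs)) zs -> is_sop a M (take k xs ++ zs).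
Proof.
move=> M_fg xs_sop zs_sop; have [cdE xs_a _] := xs_sop.
have [cd_zs zs_a _] := zs_sop.
have szE : size zs = size (drop k xs).
  by have [+ _] := sop_quotient k xs_sop; rewrite cd_zs => -[->].
split.
- by rewrite size_cat szE -size_cat cat_take_drop.
- by move=> x /=; rewrite mem_cat => /orP[/mem_take/xs_a //|/zs_a].
apply: same_radical_sub.
  by move=> x /=; rewrite mem_cat => /orP[/mem_take/xs_a //|/zs_a].
move=> r /(sop_radical zs_sop)/radical_mod_annP[n [s [zs_s rsN]]].
have [m [t [xs_t rstM]]] : exists m t, gen_ideal (take k xs) t /\
    ann M ((r ^+ n - s) ^+ m - t).
  apply: determinant_trick => // v; apply/proj_eq0.
  by rewrite linearZ_LR; apply: rsN.
have [q qE] := exprD_mod (r ^+ n - s) s m.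
apply/radical_mod_annP; exists (n * m)%N, (t + s * q); split.
  apply: idealD (gen_ideal_ideal _) _ _.
    by move: xs_t; apply: gen_ideal_subset => x; rewrite mem_cat => ->.
  apply: idealMr (gen_ideal_ideal _) _.
  by move: zs_s; apply: gen_ideal_subset => x; rewrite mem_cat orbC => ->.
have -> // : r ^+ (n * m) - (t + s * q) = (r ^+ n - s) ^+ m - t.
by rewrite exprM -{1}(subrK s (r ^+ n)) qE; ring.
Qed.

End SystemsOfParameters.

(** * Equivalence of the three conditions *)

Lemma smul_eq0 (R : comPzRingType) (a : set R) (V : lmodType R) (W : set V) :
  is_submodule W ->
  smul a W = [set 0] <-> forall r v, a r -> W v -> r *: v = 0.
Proof.
move=> Ws; split=> [aW0 r v ar Wv|aW0].
  have : smul a W (r *: v) by apply: sub_span; exists r => //; exists v.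
  by rewrite aW0.
apply/seteqP; split=> [|_ ->]; last exact: submod0 (is_submodule_span _).
apply: span_min; first exact: is_submodule0.
by move=> _ [r ar [v Wv <-]]; apply: aW0.
Qed.

Theorem theorem4p8 (R : comPzRingType) (a : set R) (M : lmodType R)
    (R_noeth : noetherian R)
    (a_ideal : is_ideal a) (a_jac : a `<=` @jacobson_radical R)
    (M_fg : fin_gen M) (cd_ara : cd a M = ara a M) :
  let cond_i :=
    forall xs : seq R, is_sop a M xs -> forall k : nat, (k < size xs)%N ->
      smul a (Gamma (gen_ideal [:: xs`_k]) (quot_seq M (take k xs)))
        = [set 0] in
  let cond_ii := relative_Buchsbaum a M in
  let cond_iii :=
    forall xs : seq R, is_sop a M xs -> forall k : nat, (k < size xs)%N ->
      relative_quasi_Buchsbaum a (quot_seq M (take k xs)) in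
  (cond_i <-> cond_ii) /\ (cond_ii <-> cond_iii).
Proof.
move=> cond_i cond_ii cond_iii; split; split.
(* (i) -> (ii): an element of the colon is torsion with exponent 1. *)
- move=> ci; split=> // xs xs_sop k k_lt N v; rewrite /N smul_gen_idealE.
  move=> /= /proj_eq0 xv r ar; apply/proj_eq0; rewrite linearZ_LR.
  have := ci xs xs_sop k k_lt; rewrite Gamma_gen_ideal.
  move=> /(smul_eq0 _ (@is_submodule_torsion _ _ _)); apply=> // x.
  by rewrite inE => /eqP ->; exists 1%N; rewrite expr1 -linearZ_LR.
- move=> [_ _ weak] xs xs_sop k k_lt; rewrite Gamma_gen_ideal.
  apply/(smul_eq0 _ (@is_submodule_torsion _ _ _)) => r q ar xq.
  have [n xnq] := xq xs`_k (mem_head _ _).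
  have [v vE] := proj_surj q; rewrite -{q}vE in xq xnq *.
  rewrite -linearZ_LR; apply/proj_eq0.
  (* The exponent n + 1 keeps the new entry in a even when n = 0. *)
  pose zs := take k xs ++ xs`_k ^+ n.+1 :: drop k.+1 xs.
  have xsE : xs = take k xs ++ xs`_k :: drop k.+1 xs.
    by rewrite -drop_nth // cat_take_drop.
  have sz_take : size (take k xs) = k by rewrite size_take k_lt.
  have zs_take : take k zs = take k xs by rewrite take_size_cat.
  have zs_k : zs`_k = xs`_k ^+ n.+1 by rewrite nth_cat sz_take ltnn subnn.
  have k_zs : (k < size zs)%N.
    by rewrite size_cat sz_take /= -addSnnS leq_addr.
  have [_ xs_a _] := xs_sop.
  have zs_sop : is_sop a M zs.
    apply: (sop_replace R_noeth a_ideal xs_sop).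
    + by rewrite [in RHS]xsE !size_cat.
    + move=> x /=; rewrite mem_cat inE => /or3P[/mem_take|/eqP ->|/mem_drop].
      * exact: xs_a.
      * by rewrite exprS; apply: idealMr => //; apply: xs_a; apply: mem_nth.
      * exact: xs_a.
    + move=> x /=; rewrite {1}xsE mem_cat inE => /or3P[x_xs|/eqP ->|x_xs].
      * apply: radical_mod_ann_id; apply: mem_gen_ideal.
        by rewrite mem_cat x_xs.
      * apply/radical_mod_annP; exists n.+1, (xs`_k ^+ n.+1).
        rewrite subrr; split; last exact: ideal0 (is_ideal_ann M).
        by apply: mem_gen_ideal; rewrite mem_cat mem_head orbT.
      * apply: radical_mod_ann_id; apply: mem_gen_ideal.
        by rewrite mem_cat inE x_xs !orbT.
  have := weak zs zs_sop k k_zs; rewrite /= zs_take zs_k smul_gen_idealE.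
  move=> /(_ v); apply=> //; apply/proj_eq0; rewrite linearZ_LR.
  exact: expr_scale0_le xnq.
- move=> [_ _ weak] xs xs_sop k k_lt.
  split; first exact: quot_seq_fin_gen.
    by have [-> ->] := sop_quotient R_noeth a_ideal k xs_sop.
  move=> zs zs_sop _ i i_lt N q; have [v <-] := proj_surj q.
  have sz_take : size (take k xs) = k by rewrite size_take k_lt.
  (* Place i of [zs] on the quotient is place k + i of the prolonged a-s.o.p on M. *)
  have yzs_sop := sop_lift R_noeth a_ideal M_fg xs_sop zs_sop.
  have := weak _ yzs_sop (k + i)%N; rewrite size_cat sz_take ltn_add2l.
  move=> /(_ i_lt) /=; rewrite smul_gen_idealE take_cat sz_take nth_cat sz_take.
  rewrite ltnNge leq_addr addKn /= => /(_ v) weak_v.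
  rewrite /N [smul (gen_ideal (take i zs)) _]smul_gen_idealE => zv r ar.
  rewrite -linearZ_LR; apply/combo_proj/weak_v => //.
  by apply/combo_proj; rewrite linearZ_LR.
- move=> ciii; split=> // xs xs_sop k k_lt N v; rewrite /N smul_gen_idealE.
  move=> /= /proj_eq0 xv r ar; apply/proj_eq0.
  have [_ _ weak] := ciii xs xs_sop k k_lt.
  have xs'_sop := sop_quotient_drop R_noeth a_ideal k xs_sop.
  (* Squares lie in a^2 and keep the radical; only place 0 of their weak-sequence condition on the
     quotient is used. *)
  pose zs := [seq x ^+ 2 | x <- drop k xs].
  have zs_a2 : [set` zs] `<=` ideal_exp a 2.
    move=> _ /mapP[x /mem_drop x_xs ->]; apply: ideal_exp_expr.
    by have [_ + _] := xs_sop; apply.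
  have zs_sop : is_sop a (quot_seq M (take k xs)) zs.
    apply: (sop_replace R_noeth a_ideal xs'_sop); first by rewrite size_map.
      move=> _ /mapP[x /mem_drop x_xs ->]; rewrite expr2.
      by apply: idealMr => //; have [_ + _] := xs_sop; apply.
    move=> x x_xs; apply/radical_mod_annP; exists 2%N, (x ^+ 2).
    rewrite subrr; split; last exact: ideal0 (is_ideal_ann _).
    by apply: mem_gen_ideal; apply: map_f.
  have := weak zs zs_sop zs_a2 0%N; rewrite size_map size_drop subn_gt0.
  move=> /(_ k_lt) /=; rewrite take0.
  rewrite [smul (gen_ideal [::]) _]smul_gen_idealE => weak0.
  rewrite linearZ_LR; apply: weak0 => //=.
  rewrite (nth_map 0) ?size_drop ?subn_gt0 // nth_drop addn0.
  rewrite linearZ_LR in xv.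
  by rewrite /colon_elt /= expr2 -scalerA xv scaler0.
Qed.
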